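(* Let $X$ be a locally compact Hausdorff space, let $\mathcal{H}$ be a finite-dimensional complex Hilbert space, and let $\nu_1,\nu_2\in\mathrm{POVM}^1_{\mathcal{H}}(X)$ satisfy $\nu_2\ll_{\rm ac}\nu_1$. If $\psi:X\to\mathcal{B}(\mathcal{H})$ is a $\nu_2$-integrable quantum random variable, then $\psi\boxtimes\frac{\mathrm{d}\nu_2}{\mathrm{d}\nu_1}$ is a $\nu_1$-integrable quantum random variable and $$\mathbb{E}_{\nu_2}[\psi]=\mathbb{E}_{\nu_1}\left[\psi\boxtimes\frac{\mathrm{d}\nu_2}{\mathrm{d}\nu_1}\right].$$
   Context: Let $d=\dim\mathcal{H}$; $\mathcal{O}(X)$ is the Borel $\sigma$-algebra of $X$; $\mathcal{B}(\mathcal{H})_+$ is the cone of positive operators. A state is a positive operator $\rho$ with $\operatorname{Tr}(\rho)=1$. A positive operator valued measure is a function $\nu:\mathcal{O}(X)\to\mathcal{B}(\mathcal{H})$ with $\nu(E)\in\mathcal{B}(\mathcal{H})_+$, $\nu(X)\ne0$, countably additive on pairwise disjoint families ($\sigma$-weak convergence); $\mathrm{POVM}^1_{\mathcal{H}}(X)$ is the set of those with $\nu(X)=1$. $\nu_2\ll_{\rm ac}\nu_1$ means $\nu_2(E)=0$ whenever $\nu_1(E)=0$. A quantum random variable is a function $\psi:X\to\mathcal{B}(\mathcal{H})$ such that $x\mapsto\operatorname{Tr}(\rho\psi(x))$ is measurable for every state $\rho$. For a positive operator valued measure $\nu:\mathcal{O}(X)\to\mathcal{B}(\mathcal{H})$,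 $\mu_\nu=\frac1d\operatorname{Tr}\circ\nu$, and $\mathrm{d}\nu/\mathrm{d}\mu_\nu:X\to\mathcal{B}(\mathcal{H})_+$ is the Radon-Nikodým derivative: $\nu(E)=\int_E\frac{\mathrm{d}\nu}{\mathrm{d}\mu_\nu}\,\mathrm{d}\mu_\nu$ for all $E$. Write $\mu_j=\mu_{\nu_j}$. $\psi$ is $\nu$-integrable if for every state $\rho$ the function $\psi_\rho=\operatorname{Tr}\left(\rho\left(\frac{\mathrm{d}\nu}{\mathrm{d}\mu_\nu}\right)^{1/2}\psi\left(\frac{\mathrm{d}\nu}{\mathrm{d}\mu_\nu}\right)^{1/2}\right)$ is $\mu_\nu$-integrable; then $\mathbb{E}_\nu[\psi]=\int_X\psi\,\mathrm{d}\nu$ is the unique operator with $\operatorname{Tr}(\rho\int_X\psi\,\mathrm{d}\nu)=\int_X\psi_\rho\,\mathrm{d}\mu_\nu$ for every state $\rho$, and $\int_E\psi\,\mathrm{d}\nu=\int_X\chi_E\psi\,\mathrm{d}\nu$. For $a\in\mathcal{B}(\mathcal{H})_+$, $a^{-1}$ denotes the generalised inverse $\sum_{\lambda_j\ne0}\lambda_j^{-1}p_j$, where $a=\sum_j\lambda_jp_j$ is the spectral decomposition. The Radon-Nikodým derivative $\frac{\mathrm{d}\nu_2}{\mathrm{d}\nu_1}$ is the bounded $\nu_1$-integrable quantum random variable $\varphi$ with $\nu_2(E)=\int_E\varphi\,\mathrm{d}\nu_1$ for all $E$; the paper cites a Radon-Nikodým theorem according to which, for $\nu_2\ll_{\rm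 ac}\nu_1$, such $\varphi$ exists, is unique up to sets of $\nu_1$-measure zero, and is given by $\varphi=\frac{\mathrm{d}\mu_2}{\mathrm{d}\mu_1}\left[\left(\frac{\mathrm{d}\nu_1}{\mathrm{d}\mu_1}\right)^{-1/2}\frac{\mathrm{d}\nu_2}{\mathrm{d}\mu_2}\left(\frac{\mathrm{d}\nu_1}{\mathrm{d}\mu_1}\right)^{-1/2}\right]$. Geometric mean: for invertible $a,b\in\mathcal{B}(\mathcal{H})_+$, $a\mathbin{\#}b=a^{1/2}(a^{-1/2}ba^{-1/2})^{1/2}a^{1/2}$; for non-invertible $a,b$, $a\mathbin{\#}b=\lim_{\varepsilon\to0+}(a+\varepsilon1)\mathbin{\#}(b+\varepsilon1)$ (strong operator topology). Definition of $\boxtimes$: $$\psi\boxtimes\frac{\mathrm{d}\nu_2}{\mathrm{d}\nu_1}=\left(\left(\frac{\mathrm{d}\nu_1}{\mathrm{d}\mu_1}\right)^{-1}\mathbin{\#}\frac{\mathrm{d}\nu_2}{\mathrm{d}\nu_1}\right)\left(\frac{\mathrm{d}\nu_1}{\mathrm{d}\mu_1}\right)^{1/2}\psi\left(\frac{\mathrm{d}\nu_1}{\mathrm{d}\mu_1}\right)^{1/2}\left(\left(\frac{\mathrm{d}\nu_1}{\mathrm{d}\mu_1}\right)^{-1}\mathbin{\#}\frac{\mathrm{d}\nu_2}{\mathrm{d}\nu_1}\right).$$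
   Formalization: Absolute continuity alone does not ensure that dν2/dν1 exists when dν1/dμ1 is singular; the formal theorem assumes a positive (not necessarily bounded) derivative φ with ν2(E)=∫_E φ dν1 for all E, equal ν1-a.e. to the paper's explicit formula. *)

(* Defs.v *)
(* A finite-dimensional complex Hilbert space is C^n with
   its standard inner product, C = R[i], and B(H) is 'M[R[i]]_n. *)
From HB Require Import structures.
From mathcomp Require Import all_boot all_order all_algebra.
From mathcomp Require Import complex ring.
From mathcomp Require Import all_classical all_reals all_analysis.

Set Implicit Arguments.
Unset Strict Implicit.
Unset Printing Implicit Defensive.

Import Order.TTheory GRing.Theory Num.Theory numFieldNormedType.Exports.

Local Open Scope classical_set_scope.
Local Open Scope ring_scope.
Local Open Scope complex_scope.
Local Open Scope sesquilinear_scope.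
Local Open Scope charge_scope.

Section operators.
Variables (R : realType) (n : nat).
Local Notation op := 'M[R[i]]_n.
Implicit Types (a b rho : op).

(* On R[i], 0 <= z says that z is real and nonnegative, so that a positive
   operator is in particular self-adjoint. *)
Definition positive_op a : Prop :=
  forall v : 'cV[R[i]]_n, 0 <= (v ^t* *m a *m v) 0 0.

Definition state rho : Prop := positive_op rho /\ \tr rho = 1.

(* f(a) for a normal operator a; only used for positive a *)
Definition mxfun (f : R[i] -> R[i]) a : op :=
  invmx (spectralmx a) *m diag_mx (map_mx f (spectral_diag a))
    *m spectralmx a.

Definition sqrtop : op -> op := mxfun sqrtC.

(* As 0^-1 = 0 in R[i], this inverts the nonzero eigenvalues only. *)
Definition ginv : op -> op := mxfun (fun z => z^-1).

Definition gmean_unit a b : op :=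
  sqrtop a *m sqrtop (sqrtop (ginv a) *m b *m sqrtop (ginv a)) *m sqrtop a.

(* strong operator limit of F(e) as e -> 0+ *)
Definition sot_cvg0 (F : R -> op) a : Prop :=
  forall v : 'cV[R[i]]_n,
    F e *m v @[e --> 0^'+] --> (a *m v : 'cV[R[i]^o]_n).

Definition gmean a b : op :=
  if (a \in unitmx) && (b \in unitmx) then gmean_unit a b
  else xget 0 [set c | sot_cvg0
    (fun e => gmean_unit (a + (e%:C)%:M) (b + (e%:C)%:M)) c].

Lemma state_rank1 (v : 'cV[R[i]]_n) : (v ^t* *m v) 0 0 != 0 ->
  state (((v ^t* *m v) 0 0)^-1 *: (v *m v ^t*)).
Proof.
move=> v0; split; last by rewrite mxtraceZ mxtrace_mulC trace_mx11 mulVf.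
have : 0 <= ((v ^t* *m v) 0 0)^-1.
  rewrite invr_ge0 mxE sumr_ge0// => i _.
  by rewrite !mxE mulrC mul_conjC_ge0.
move: (_^-1) => c c0 w.
rewrite -scalemxAr -scalemxAl mxE mulr_ge0//.
rewrite mulmxA -(mulmxA (w ^t* *m v)) mxE big_ord1.
have -> : (v ^t* *m w) 0 0 = Num.conj ((w ^t* *m v) 0 0).
  rewrite !mxE rmorph_sum; apply: eq_bigr => i _.
  by rewrite rmorphM !mxE /= conjCK mulrC.
by rewrite mul_conjC_ge0.
Qed.

(* the states span B(H) *)
Lemma state_span (P : op -> Prop) : P 0 ->
  (forall a b, P a -> P b -> P (a + b)) -> (forall z a, P a -> P (z *: a)) ->
  (forall rho, state rho -> P rho) -> forall a, P a.
Proof.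
move=> P0 PD PZ Pst.
have P1 (v : 'cV[R[i]]_n) : P (v *m v ^t*).
  have [v0|v0] := eqVneq ((v ^t* *m v) 0 0) 0.
    suff -> : v = 0 by rewrite mul0mx.
    apply/matrixP => i j; rewrite !ord1 mxE; apply/eqP.
    move: v0 => /eqP; rewrite mxE psumr_eq0 => [/allP /(_ i)|k _].
      by rewrite mem_index_enum !mxE mulrC mul_conjC_eq0 => /(_ isT).
    by rewrite !mxE mulrC mul_conjC_ge0.
  rewrite -[X in P X](scalerKV v0).
  by apply: PZ; apply: Pst; exact: state_rank1.
have P2 (u v : 'cV[R[i]]_n) : P (u *m v ^t*).
  have -> : u *m v ^t* = 2^-1 *: ((u + v) *m (u + v) ^t*
    + 'i *: ((u + 'i *: v) *m (u + 'i *: v) ^t*)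
    + - (1 + 'i) *: (u *m u ^t* + v *m v ^t*)).
    apply/matrixP => i j; rewrite !mxE !big_ord1 !mxE.
    move: (u i _) (u j _) (v i _) (v j _) => x y z t.
    rewrite !rmorphD !rmorphM/= conjCi; have := @sqrCi R[i].
    move: (Num.conj y) (Num.conj t) 'i%R => y' t' I II.
    by field: II.
  apply: (PZ _ _ _); apply: (PD _ _ _ _).
    by apply: (PD _ _ _ _) => //; apply: (PZ _ _ _).
  by apply: (PZ _ _ _); apply: (PD _ _ _ _).
move=> a; rewrite (matrix_sum_delta a).
apply: (big_ind P) => // i _; apply: (big_ind P) => // j _; apply: PZ.
suff -> : delta_mx i j =
  (delta_mx i 0 : 'cV[R[i]]_n) *m (delta_mx j 0 : 'cV[R[i]]_n) ^t* :> op by [].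
by rewrite trmx_delta map_delta_mx mul_delta_mx.
Qed.

End operators.

Section complex_integral.
Context d (T : measurableType d) (R : realType).
Variables (mu : {measure set T -> \bar R}).
Implicit Type f : T -> R[i].

Definition cmeasurable f : Prop :=
  measurable_fun setT (fun x => complex.Re (f x)) /\
  measurable_fun setT (fun x => complex.Im (f x)).

Definition cintegrable f : Prop :=
  mu.-integrable setT (fun x => (complex.Re (f x))%:E) /\
  mu.-integrable setT (fun x => (complex.Im (f x))%:E).

Definition cintegral (E : set T) f : R[i] :=
  (\int[mu]_(x in E) complex.Re (f x)) +i*
  (\int[mu]_(x in E) complex.Im (f x)).

Let Re_ f := fun x => complex.Re (f x).
Let Im_ f := fun x => complex.Im (f x).

Lemma cintegrableD f g : cintegrable f -> cintegrable g ->
  cintegrable (fun x => f x + g x).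
Proof.
move=> [f1 f2] [g1 g2]; split.
- apply: eq_integrable (integrableD measurableT f1 g1) => // x _ /=.
  by case: (f x) (g x) => [? ?] [? ?].
- apply: eq_integrable (integrableD measurableT f2 g2) => // x _ /=.
  by case: (f x) (g x) => [? ?] [? ?].
Qed.

Lemma cintegralD f g : cintegrable f -> cintegrable g ->
  cintegral setT (fun x => f x + g x) = cintegral setT f + cintegral setT g.
Proof.
move=> [f1 f2] [g1 g2]; rewrite /cintegral.
rewrite (_ : (fun x => complex.Re (f x + g x)) = Re_ f \+ Re_ g); last first.
  by apply/funext => x; rewrite /= /Re_; case: (f x) (g x) => [? ?] [? ?].
rewrite (_ : (fun x => complex.Im (f x + g x)) = Im_ f \+ Im_ g); last first.
  by apply/funext => x; rewrite /= /Im_; case: (f x) (g x) => [? ?] [? ?].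
by rewrite !RintegralD.
Qed.

Lemma cintegrableZ c f : cintegrable f -> cintegrable (fun x => c * f x).
Proof.
case: c => a b [f1 f2]; split.
- apply: eq_integrable (integrableB measurableT (integrableZl measurableT a f1)
    (integrableZl measurableT b f2)) => // x _ /=.
  by case: (f x) => u v /=; rewrite -EFinM -EFinB.
- apply: eq_integrable (integrableD measurableT (integrableZl measurableT a f2)
    (integrableZl measurableT b f1)) => // x _ /=.
  by case: (f x) => u v.
Qed.

Lemma cintegralZ c f : cintegrable f ->
  cintegral setT (fun x => c * f x) = c * cintegral setT f.
Proof.
case: c => a b [f1 f2]; rewrite /cintegral.
have I k g : mu.-integrable setT (EFin \o g) ->
  mu.-integrable setT (EFin \o (fun x => k * g x)).
  by move=> ig; apply: eq_integrable (integrableZl measurableT k ig) => //.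
rewrite (_ : (fun x => complex.Re (_ * f x)) =
  (fun x => a * Re_ f x) \- (fun x => b * Im_ f x)); last first.
  by apply/funext => x; rewrite /= /Re_ /Im_; case: (f x).
rewrite (_ : (fun x => complex.Im (_ * f x)) =
  (fun x => a * Im_ f x) \+ (fun x => b * Re_ f x)); last first.
  by apply/funext => x; rewrite /= /Re_ /Im_; case: (f x).
by rewrite RintegralB ?RintegralD ?RintegralZl//; do ?exact: I.
Qed.

End complex_integral.

(* quantum random variable *)
Definition qrv d (T : measurableType d) (R : realType) n
    (psi : T -> 'M[R[i]]_n) : Prop :=
  forall rho, state rho -> cmeasurable (fun x => \tr (rho *m psi x)).

(* The values of a POVM outside the sigma-algebra are irrelevant.  The
   condition on povm_setT forces n > 0. *)
Record povm d (T : measurableType d) (R : realType) n := POVM {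
  povm_fun :> set T -> 'M[R[i]]_n;
  povm_positive : forall E, measurable E -> positive_op (povm_fun E);
  povm_setT : povm_fun setT != 0;
  povm_sigma_additive : forall F : (set T)^nat,
    (forall k, measurable (F k)) -> trivIset setT F ->
    forall rho : 'M[R[i]]_n,
      \tr (rho *m \sum_(k < m) povm_fun (F k)) @[m --> \oo] -->
      (\tr (rho *m povm_fun (\bigcup_k F k)) : R[i]^o)
}.

Section trace_measure.
Context d (T : measurableType d) (R : realType) (n : nat).
Variable nu : povm T R n.

(* mu_nu = (1/n) Tr o nu, extended by 0 to nonmeasurable sets because a
   library measure is a nonnegative function on all sets *)
Definition trace_measure (E : set T) : \bar R :=
  if E \in measurable then ((n%:R)^-1 * complex.Re (\tr (nu E)))%:E else 0%E.

Lemma positive_op_trace_ge0 (a : 'M[R[i]]_n) :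
  positive_op a -> 0 <= complex.Re (\tr a).
Proof.
move=> a0; suff: 0 <= \tr a by case: (\tr a) => u v; rewrite lecE => /andP[].
apply: sumr_ge0 => i _; have := a0 (delta_mx i 0).
by rewrite trmx_delta map_delta_mx -rowE -colE !mxE.
Qed.

Let mu := trace_measure.

Let muE E : measurable E ->
  mu E = ((n%:R)^-1 * complex.Re (\tr (nu E)))%:E.
Proof. by move=> mE; rewrite /mu /trace_measure mem_set. Qed.

Lemma povm_trace_cvg (F : (set T)^nat) :
  (forall k, measurable (F k)) -> trivIset setT F ->
  (\sum_(k < m) complex.Re (\tr (nu (F k)))) @[m --> \oo] -->
  complex.Re (\tr (nu (\bigcup_k F k))).
Proof.
move=> mF tF; have := @povm_sigma_additive _ _ _ _ nu F mF tF 1%:M.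
move=> /(@cvgrPdist_lt R[i] R[i]^o nat \oo _ _ _) H.
apply/cvgrPdist_lt => e e0.
have e0' : 0 < e%:C :> R[i] by rewrite ltcR.
have := H _ e0'; apply: filterS => m /=.
rewrite !mul1mx; set z := (_ - _ : R[i]^o) => zlt.
have -> : complex.Re (\tr (nu (\bigcup_k F k))) -
   \sum_(k < m) complex.Re (\tr (nu (F k))) = complex.Re (z : R[i]).
  have ReB (x y : R[i]) : complex.Re (x - y) = complex.Re x - complex.Re y.
    by case: x y => ? ? [].
  have ReD : {morph (@complex.Re R) : x y / x + y} by move=> [? ?] [].
  rewrite /z ReB; congr (_ - _).
  rewrite (big_morph _ (@mxtraceD _ _) (@mxtrace0 _ _)).
  by rewrite (big_morph _ ReD (erefl _)).
by rewrite -ltcR; apply: le_lt_trans zlt; exact: normc_ge_Re.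
Qed.

Let mu0 : mu set0 = 0%E.
Proof.
rewrite muE//; set r := complex.Re _; suff -> : r = 0 by rewrite mulr0.
have tF : trivIset setT (fun _ : nat => @set0 T).
  by move=> i j _ _; rewrite setI0 => /set0P; rewrite eqxx.
have := @povm_trace_cvg (fun=> set0) (fun=> measurable0) tF.
rewrite bigcup0// -/r => H.
have H1 : (\sum_(k < m.+1) r) @[m --> \oo] --> r by move: H; rewrite -cvg_shiftS.
have H2 := cvgB H1 H; rewrite subrr in H2.
have : (fun _ : nat => r) @ \oo --> (0 : R).
  rewrite (_ : (fun=> r) =
    fun m : nat => (\sum_(k < m.+1) r) - (\sum_(k < m) r)); first exact: H2.
  by apply/funext => m /=; rewrite !sumr_const !card_ord mulrSr addrAC subrr add0r.
move=> /(cvg_lim (@Rhausdorff R)); rewrite lim_cst//; exact: Rhausdorff.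
Qed.

Let mu_ge0 E : (0 <= mu E)%E.
Proof.
rewrite /mu /trace_measure; case: ifPn => // /set_mem mE.
by rewrite lee_fin mulr_ge0 ?invr_ge0 ?positive_op_trace_ge0//; exact: povm_positive.
Qed.

Let mu_sigma : semi_sigma_additive mu.
Proof.
move=> F mF tF mUF; rewrite muE//.
have -> : (fun m => \sum_(0 <= i < m) mu (F i))%E =
  EFin \o (fun m => (n%:R)^-1 * \sum_(k < m) complex.Re (\tr (nu (F k)))).
  apply/funext => m /=; rewrite big_mkord mulr_sumr -sumEFin.
  by apply: eq_bigr => i _; rewrite muE.
by apply: cvg_EFin; [near=> m|apply: cvgMr; exact: povm_trace_cvg].
Unshelve. all: by end_near. Qed.

HB.instance Definition _ := isMeasure.Build _ T R mu mu0 mu_ge0 mu_sigma.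

Let mu_fin : fin_num_fun mu.
Proof. by move=> E mE; rewrite muE. Qed.

HB.instance Definition _ := Measure_isFinite.Build _ T R mu mu_fin.

End trace_measure.

Section povm_integration.
Context d (T : measurableType d) (R : realType) (n : nat).
Local Notation op := 'M[R[i]]_n.
Implicit Types (nu : povm T R n) (A phi psi : T -> op).

(* A is a version of d nu / d mu_nu; the operator-valued integral is taken
   entrywise. *)
Definition is_density nu A : Prop :=
  [/\ forall x, positive_op (A x),
      forall i j, cintegrable (trace_measure nu) (fun x => A x i j) &
      forall E, measurable E -> nu E =
        \matrix_(i, j) cintegral (trace_measure nu) E (fun x => A x i j)].

(* In what follows A stands for a version of d nu / d mu_nu. *)
Definition psi_state A psi (rho : op) (x : T) : R[i] :=
  \tr (rho *m (sqrtop (A x) *m psi x *m sqrtop (A x))).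

Definition povm_integrable nu A psi : Prop :=
  forall rho, state rho ->
    cintegrable (trace_measure nu) (psi_state A psi rho).

Definition povm_expectation nu A psi : op :=
  xget 0 [set c : op | forall rho, state rho ->
    \tr (rho *m c) = cintegral (trace_measure nu) setT (psi_state A psi rho)].

Lemma mxtrace_delta (a : op) i j : \tr (delta_mx i j *m a) = a j i.
Proof.
rewrite -(mul_delta_mx (0 : 'I_1)) -mulmxA -rowE mxtrace_mulC -colE.
by rewrite trace_mx11 !mxE.
Qed.

Lemma state_trace_inj (a b : op) :
  (forall rho, state rho -> \tr (rho *m a) = \tr (rho *m b)) -> a = b.
Proof.
move=> ab; have {}ab rho : \tr (rho *m a) = \tr (rho *m b).
  apply: (@state_span _ _ (fun r => \tr (r *m a) = \tr (r *m b))) => //.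
  - by rewrite !mul0mx.
  - by move=> x y xE yE; rewrite !mulmxDl !mxtraceD xE yE.
  - by move=> z x xE; rewrite -!scalemxAl !mxtraceZ xE.
by apply/matrixP => i j; rewrite -!mxtrace_delta.
Qed.

Lemma povm_integrable_psi_state nu A psi rho : povm_integrable nu A psi ->
  cintegrable (trace_measure nu) (psi_state A psi rho).
Proof.
move=> ipsi; pose P r := cintegrable (trace_measure nu) (psi_state A psi r).
apply: (@state_span _ _ P) => //.
- rewrite /P /psi_state; under eq_fun do rewrite mul0mx mxtrace0.
  by split; exact: integrable0.
- move=> a b ia ib; rewrite /P /psi_state.
  by under eq_fun do rewrite mulmxDl mxtraceD; exact: cintegrableD.
- move=> z a ia; rewrite /P /psi_state.
  by under eq_fun do rewrite -scalemxAl mxtraceZ; exact: cintegrableZ.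
Qed.

(* existence and uniqueness of the operator defining the expectation *)
Lemma povm_expectationP nu A psi : povm_integrable nu A psi ->
  forall c, (forall rho, state rho -> \tr (rho *m c) =
      cintegral (trace_measure nu) setT (psi_state A psi rho)) <->
    c = povm_expectation nu A psi.
Proof.
move=> ipsi.
have ientry rho := @povm_integrable_psi_state nu A psi rho ipsi.
pose c0 := \matrix_(i, j)
  cintegral (trace_measure nu) setT (psi_state A psi (delta_mx j i)).
have c0E i j : c0 i j =
    cintegral (trace_measure nu) setT (psi_state A psi (delta_mx j i)).
  by rewrite mxE.
move: c0 c0E => c0 c0E.
have c0P rho : \tr (rho *m c0) =
    cintegral (trace_measure nu) setT (psi_state A psi rho).
  pose P r := \tr (r *m c0) =
    cintegral (trace_measure nu) setT (psi_state A psi r).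
  have P0 : P 0.
    rewrite /P /psi_state; under eq_fun do rewrite mul0mx mxtrace0.
    by rewrite mul0mx mxtrace0 /cintegral /= !Rintegral_cst// !mul0r.
  have PD a b : P a -> P b -> P (a + b).
    move=> aE bE; rewrite /P mulmxDl mxtraceD aE bE -(cintegralD (ientry a) (ientry b)).
    congr (cintegral _ _ _); apply/funext => x.
    by rewrite /psi_state mulmxDl mxtraceD.
  have PZ z a : P a -> P (z *: a).
    move=> aE; rewrite /P -scalemxAl mxtraceZ aE -(cintegralZ _ (ientry a)).
    congr (cintegral _ _ _); apply/funext => x.
    by rewrite /psi_state -scalemxAl mxtraceZ.
  suff : P rho by [].
  rewrite (matrix_sum_delta rho).
  apply: (big_ind P P0 PD) => i _; apply: (big_ind P P0 PD) => j _; apply: PZ.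
  by rewrite /P mxtrace_delta; exact: c0E.
have EP : forall rho, state rho -> \tr (rho *m povm_expectation nu A psi) =
    cintegral (trace_measure nu) setT (psi_state A psi rho).
  rewrite /povm_expectation; case: xgetP => [c _ //|/(_ c0) []].
  by move=> rho _; exact: c0P.
move=> c; split=> [cP|->//]; apply: state_trace_inj => rho srho.
by rewrite cP// EP.
Qed.

Definition povm_integral nu A (E : set T) psi : op :=
  povm_expectation nu A (fun x => (\1_E x)%:C *: psi x).

Definition povm_ac nu2 nu1 : Prop :=
  forall E, measurable E -> nu1 E = 0 -> nu2 E = 0.

Definition povm_ae nu (P : T -> Prop) : Prop :=
  exists N, [/\ measurable N, nu N = 0 & forall x, ~ N x -> P x].

(* The explicit expression of d nu2 / d nu1, where Aj is a version of
   d nu_j / d mu_j; the scalar factor is d mu2 / d mu1. *)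
Definition RN_formula nu1 nu2 A1 A2 (x : T) : op :=
  (fine (('d (charge_of_finite_measure (trace_measure nu2))
          '/d (trace_measure nu1)) x))%:C *:
  (sqrtop (ginv (A1 x)) *m A2 x *m sqrtop (ginv (A1 x))).

(* phi is a version of d nu2 / d nu1.  Where d nu1 / d mu1 is singular, the
   integral identity determines only the compression of phi to the range of
   d nu1 / d mu1; the last clause selects the phi vanishing off that range,
   as in the explicit expression.  Boundedness is not imposed: for n = 1 the
   derivative is the classical density of nu2 with respect to nu1, which may
   be unbounded. *)
Definition is_RN_derivative nu1 nu2 A1 A2 phi : Prop :=
  [/\ forall x, positive_op (phi x),
      qrv phi,
      povm_integrable nu1 A1 phi,
      forall E, measurable E -> nu2 E = povm_integral nu1 A1 E phi &
      povm_ae nu1 (fun x => phi x = RN_formula nu1 nu2 A1 A2 x)].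

(* psi [x] d nu2 / d nu1, for the versions A1 of d nu1 / d mu1 and phi of
   d nu2 / d nu1 *)
Definition boxtimes A1 phi psi (x : T) : op :=
  let g := gmean (ginv (A1 x)) (phi x) in
  g *m sqrtop (A1 x) *m psi x *m sqrtop (A1 x) *m g.

End povm_integration.

Definition borel (X : ptopologicalType) := g_sigma_algebraType (@open X).

(* Main.v *)
Require Import Defs.
From HB Require Import structures.
From mathcomp Require Import all_boot all_order all_algebra.
From mathcomp Require Import complex ring.
From mathcomp Require Import all_classical all_reals all_analysis.
From mathcomp Require Import measurable_realfun.

(** Write a and b for the densities of nu1 and nu2 with respect to their trace
    measures mu1 and mu2, r for the derivative of mu2 with respect to mu1, s for
    the square root of a, and g for the geometric mean of the generalised
    inverse of a with phi.  Everything rests on the identity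
      s (g s psi s g) s = r b^(1/2) psi b^(1/2)   mu1-almost everywhere
    ([product_sandwich]): the trace of its left side against a state is what is
    integrated against mu1 in the expectation for nu1, and the factor r turns
    the integral of the right side into one against mu2
    ([density_cintegral]).  The identity holds because
    - s phi s = r b almost everywhere, both sides having the same integral over
      every measurable set, namely nu2 of it ([RN_derivative_compression]);
    - s g s is the square root of s phi s when phi lives on the range of a
      ([gmean_ginv_sandwich]).  For invertible a this is the definition of the
      mean.  In general the mean is a limit of means of invertible operators;
      those satisfy an analogous equation ([perturbed_sandwich]), which passes
      to the limit, and a positive operator is the square root of its square.

    The product must also be measurable, and at every point: on a null set
    phi can take any positive values.  So the limit defining the mean has to
    exist for all positive operators.  It does, since the means
    of x + e and y + e decrease with e ([gmean_unit_shift_le]): the square root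
    is operator monotone ([positive_sqr_le]) and the mean is symmetric
    ([gmean_unitC]).  Measurability of the mean then follows from that of the
    square root and of the generalised inverse, which are limits of polynomials
    ([mxmeasurable_sqrtop], [mxmeasurable_ginv]). *)

Module ChangeOfMeasure.

Set Implicit Arguments.
Unset Strict Implicit.
Unset Printing Implicit Defensive.

Import Order.TTheory GRing.Theory Num.Theory numFieldNormedType.Exports.

Local Open Scope classical_set_scope.
Local Open Scope ring_scope.
Local Open Scope complex_scope.
Local Open Scope sesquilinear_scope.
Local Open Scope charge_scope.

(** * Positive operators and functional calculus *)

Section quadratic_form.
Variables (R : realType) (n : nat).
Local Notation C := R[i].
Local Notation op := 'M[C]_n.
Implicit Types (a b : op) (u v : 'cV[C]_n).

Lemma ctmxM m p q (a : 'M[C]_(m, p)) (b : 'M[C]_(p, q)) :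
  (a *m b) ^t* = b ^t* *m a ^t*.
Proof. by rewrite trmx_mul map_mxM. Qed.

Lemma ctmxD m p (a b : 'M[C]_(m, p)) : (a + b) ^t* = a ^t* + b ^t*.
Proof. by rewrite linearD /= map_mxD. Qed.

Lemma ctmxZ m p z (a : 'M[C]_(m, p)) : (z *: a) ^t* = Num.conj z *: a ^t*.
Proof. by rewrite linearZ /= map_mxZ. Qed.

Lemma ctmxN m p (a : 'M[C]_(m, p)) : (- a) ^t* = - a ^t*.
Proof. by apply/matrixP => i j; rewrite !mxE rmorphN. Qed.

Lemma ctmx1 : (1%:M : op) ^t* = 1%:M.
Proof. by rewrite trmx1 map_mx1. Qed.

Definition sesq a u v : C := (u ^t* *m a *m v) 0 0.

Lemma sesqDl a u u' v : sesq a (u + u') v = sesq a u v + sesq a u' v.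
Proof. by rewrite /sesq ctmxD 2!mulmxDl mxE. Qed.

Lemma sesqDr a u v v' : sesq a u (v + v') = sesq a u v + sesq a u v'.
Proof. by rewrite /sesq mulmxDr mxE. Qed.

Lemma sesqZl a z u v : sesq a (z *: u) v = Num.conj z * sesq a u v.
Proof. by rewrite /sesq ctmxZ -mulmxA -scalemxAl mulmxA mxE. Qed.

Lemma sesqZr a z u v : sesq a u (z *: v) = z * sesq a u v.
Proof. by rewrite /sesq -scalemxAr mxE. Qed.

Definition qform a v : C := sesq a v v.

Lemma polarization a u v : sesq a u v =
  2^-1 * (qform a (u + v) - 'i * qform a (u + 'i *: v)
          - (1 - 'i) * (qform a u + qform a v)).
Proof.
rewrite /qform !(sesqDl, sesqDr) sesqZl sesqZr sesqZl sesqZr conjCi.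
have := @sqrCi R[i].
move: (sesq a u u) (sesq a u v) (sesq a v u) (sesq a v v) 'i%R.
move=> x y z t I II.
by field: II.
Qed.

Lemma qformD a b v : qform (a + b) v = qform a v + qform b v.
Proof. by rewrite /qform /sesq mulmxDr mulmxDl mxE. Qed.

Lemma qformN a v : qform (- a) v = - qform a v.
Proof. by rewrite /qform /sesq mulmxN mulNmx mxE. Qed.

Lemma qformB a b v : qform (a - b) v = qform a v - qform b v.
Proof. by rewrite qformD qformN. Qed.

Lemma qformZ z a v : qform (z *: a) v = z * qform a v.
Proof. by rewrite /qform /sesq -scalemxAr -scalemxAl mxE. Qed.

Lemma qform_conj a b v : qform (b ^t* *m a *m b) v = qform a (b *m v).
Proof. by rewrite /qform /sesq ctmxM !mulmxA. Qed.

Lemma qform1_ge0 v : 0 <= qform 1%:M v.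
Proof.
rewrite /qform /sesq mulmx1 mxE sumr_ge0 // => i _.
by rewrite !mxE mulrC mul_conjC_ge0.
Qed.

Lemma qform_adj a v : qform (a ^t*) v = Num.conj (qform a v).
Proof.
have -> : qform (a ^t*) v = ((v ^t* *m a *m v) ^t*) 0 0.
  by rewrite !ctmxM trmxCK mulmxA.
by rewrite [LHS]mxE [in LHS]mxE.
Qed.

Lemma entry_sesquilinear a i j :
  a i j = sesq a (delta_mx i 0) (delta_mx j 0).
Proof. by rewrite /sesq trmx_delta map_delta_mx -rowE -colE !mxE. Qed.

Lemma qform_inj a b : qform a =1 qform b -> a = b.
Proof.
by move=> ab; apply/matrixP => i j; rewrite !entry_sesquilinear !polarization !ab.
Qed.

(** By polarization an operator is determined by its quadratic form, and the
    form of the adjoint is the conjugate one. *)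
Lemma positive_adj a : positive_op a -> a ^t* = a.
Proof.
move=> a0; apply: qform_inj => v.
by rewrite qform_adj conj_Creal// realE (a0 v).
Qed.

Lemma positive_opD a b : positive_op a -> positive_op b -> positive_op (a + b).
Proof.
move=> a0 b0 v; rewrite -[X in _ <= X]/(qform _ v) qformD.
by rewrite addr_ge0 //; [exact: a0|exact: b0].
Qed.

Lemma positive_opZ z a : 0 <= z -> positive_op a -> positive_op (z *: a).
Proof.
move=> z0 a0 v; rewrite -[X in _ <= X]/(qform _ v) qformZ.
by rewrite mulr_ge0 //; exact: a0.
Qed.

Lemma positive_op_conj a b : positive_op a -> positive_op (b ^t* *m a *m b).
Proof. by move=> a0 v; rewrite -[X in _ <= X]/(qform _ v) qform_conj; exact: a0. Qed.

Lemma positive_op_scalar z : 0 <= z -> positive_op (z%:M : op).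
Proof.
by move=> z0; rewrite -scalemx1; apply: positive_opZ => //; exact: qform1_ge0.
Qed.

End quadratic_form.

Section functional_calculus.
Variables (R : realType) (n : nat).
Local Notation C := R[i].
Local Notation op := 'M[C]_n.
Implicit Types (a b : op) (f g : C -> C).

Lemma normal_positive a : positive_op a -> a \is normalmx.
Proof. by move=> /positive_adj aE; apply/normalmxP; rewrite aE. Qed.

Lemma invmx_spectral a : invmx (spectralmx a) = (spectralmx a) ^t*.
Proof. exact/invmx_unitary/spectral_unitarymx. Qed.

Lemma positive_op_diag (u : op) (d : 'rV[C]_n) : u \is unitarymx ->
  (forall i, 0 <= d 0 i) -> positive_op (invmx u *m diag_mx d *m u).
Proof.
move=> uu d0; rewrite invmx_unitary//; apply: positive_op_conj => v.
rewrite -mulmxA mul_diag_mx mxE sumr_ge0 // => i _.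
by rewrite !mxE mulrCA mulr_ge0 // mulrC mul_conjC_ge0.
Qed.

Lemma spectral_vector a i : a \is normalmx ->
  a *m col i ((spectralmx a) ^t*) =
  spectral_diag a 0 i *: col i ((spectralmx a) ^t*).
Proof.
move=> /orthomx_spectralP aE; set u := spectralmx a.
have -> : a *m col i (u ^t*) = col i (a *m u ^t*) by rewrite !colE mulmxA.
rewrite {1}aE -invmx_spectral -/u mulmxK ?spectral_unit//.
by apply/matrixP => k l; rewrite mul_mx_diag !mxE mulrC.
Qed.

Lemma qform_spectral a i : a \is normalmx ->
  qform a (col i ((spectralmx a) ^t*)) = spectral_diag a 0 i.
Proof.
move=> na; rewrite /qform /sesq -mulmxA spectral_vector// -scalemxAr mxE.
set u := spectralmx a.
have -> : (col i (u ^t*)) ^t* *m col i (u ^t*) = 1%:M.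
  have -> : (col i (u ^t*)) ^t* = row i u.
    by apply/matrixP => k l; rewrite !mxE conjCK.
  have /unitarymxP uu := spectral_unitarymx a.
  rewrite colE mulmxA -row_mul uu.
  by apply/matrixP => k l; rewrite !ord1 -colE !mxE !eqxx.
by rewrite mxE mulr1.
Qed.

Lemma spectral_ge0 a i : positive_op a -> 0 <= spectral_diag a 0 i.
Proof.
by move=> a0; rewrite -qform_spectral ?normal_positive//; exact: a0.
Qed.

Lemma spectral_gt0 a i : positive_op a -> a \in unitmx ->
  0 < spectral_diag a 0 i.
Proof.
move=> a0 au; rewrite lt0r spectral_ge0// andbT.
have /orthomx_spectralP aE := normal_positive a0.
move: au; rewrite {1}aE !unitmx_mul => /andP[/andP[_ +] _].
rewrite unitmxE det_diag unitfE => /prodf_neq0; exact.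
Qed.

Lemma spectral_le_trace a i : positive_op a ->
  spectral_diag a 0 i <= \tr a.
Proof.
move=> a0; have /orthomx_spectralP aE := normal_positive a0.
rewrite [X in _ <= \tr X]aE mxtrace_mulC mulmxA mulmxV ?spectral_unit//.
rewrite mul1mx mxtrace_diag (bigD1 i)//= lerDl sumr_ge0// => j _.
exact: spectral_ge0.
Qed.

Lemma positive_trace_eq0 a : positive_op a -> \tr a = 0 -> a = 0.
Proof.
move=> a0 t0; have /orthomx_spectralP aE := normal_positive a0.
have d0 i : spectral_diag a 0 i = 0.
  apply/eqP; rewrite eq_le spectral_ge0// andbT -t0; exact: spectral_le_trace.
rewrite aE.
have -> : diag_mx (spectral_diag a) = 0.
  by apply/matrixP => i j; rewrite !mxE d0 mul0rn.
by rewrite mulmx0 mul0mx.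
Qed.

Lemma mxfun_id a : positive_op a -> mxfun id a = a.
Proof.
move=> /normal_positive/orthomx_spectralP aE.
by rewrite /mxfun map_mx_id.
Qed.

Lemma mxfun_cst z a : mxfun (fun=> z) a = z%:M.
Proof.
rewrite /mxfun.
have -> : map_mx (fun=> z) (spectral_diag a) = const_mx z.
  by apply/rowP => i; rewrite !mxE.
rewrite diag_const_mx -scalemx1 -scalemxAr -scalemxAl mulmx1 mulVmx ?spectral_unit//.
Qed.

Lemma mxfunM f g a :
  mxfun f a *m mxfun g a = mxfun (fun t => f t * g t) a.
Proof.
have uV := mulmxV (spectral_unit a); rewrite /mxfun.
move: uV; move: (invmx (spectralmx a)) => v.
move: (spectralmx a) (spectral_diag a) => u d uV.
have -> : diag_mx (map_mx (fun t => f t * g t) d) =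
    diag_mx (map_mx f d) *m diag_mx (map_mx g d).
  rewrite mulmx_diag; apply/matrixP => i j.
  by rewrite !mxE.
move: (diag_mx (map_mx f d)) (diag_mx (map_mx g d)) => x y.
by rewrite !mulmxA -(mulmxA _ u v) uV mulmx1.
Qed.

Lemma mxfunD f g a :
  mxfun f a + mxfun g a = mxfun (fun t => f t + g t) a.
Proof.
rewrite /mxfun; move: (invmx (spectralmx a)) => v.
move: (spectralmx a) (spectral_diag a) => u d.
have -> : diag_mx (map_mx (fun t => f t + g t) d) =
    diag_mx (map_mx f d) + diag_mx (map_mx g d).
  by apply/matrixP => i j; rewrite !mxE mulrnDl.
by rewrite mulmxDr mulmxDl.
Qed.

Lemma mxfunZ z f a : z *: mxfun f a = mxfun (fun t => z * f t) a.
Proof. by rewrite -mul_scalar_mx -(mxfun_cst z a) mxfunM. Qed.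

Lemma mxfunB f g a :
  mxfun f a - mxfun g a = mxfun (fun t => f t - g t) a.
Proof.
rewrite -scaleN1r mxfunZ mxfunD; congr (mxfun _ a).
by apply/funext => t; rewrite mulN1r.
Qed.

Lemma eq_mxfun f g a : positive_op a -> (forall t, 0 <= t -> f t = g t) ->
  mxfun f a = mxfun g a.
Proof.
move=> a0 fg; rewrite /mxfun.
suff -> : map_mx f (spectral_diag a) = map_mx g (spectral_diag a) by [].
by apply/rowP => i; rewrite !mxE fg// spectral_ge0.
Qed.

Lemma eq_mxfun_unit f g a : positive_op a -> a \in unitmx ->
  (forall t, 0 < t -> f t = g t) -> mxfun f a = mxfun g a.
Proof.
move=> a0 au fg; rewrite /mxfun.
suff -> : map_mx f (spectral_diag a) = map_mx g (spectral_diag a) by [].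
by apply/rowP => i; rewrite !mxE fg// spectral_gt0.
Qed.

Lemma mxfun_positive f a : positive_op a -> (forall t, 0 <= t -> 0 <= f t) ->
  positive_op (mxfun f a).
Proof.
move=> a0 f0; apply: positive_op_diag; first exact: spectral_unitarymx.
by move=> i; rewrite !mxE f0// spectral_ge0.
Qed.

(** Where w i j is nonzero, d i and e j are equal, and so are their images
    under f. *)
Lemma diag_intertwine f (d e : 'rV[C]_n) (w : op) :
  diag_mx d *m w = w *m diag_mx e ->
  diag_mx (map_mx f d) *m w = w *m diag_mx (map_mx f e).
Proof.
move=> /matrixP dw; apply/matrixP => i j; have := dw i j.
rewrite !mul_diag_mx !mul_mx_diag !mxE.
have [->|w0] := eqVneq (w i j) 0; first by rewrite !(mulr0, mul0r).
by rewrite [RHS]mulrC => /(mulIf w0) ->; rewrite mulrC.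
Qed.

(** For w = 1 this compares two diagonalisations of one operator: applying f
    to the eigenvalues gives the same result in both. *)
Lemma diag_intertwine_conj f (u v w : op) (d e : 'rV[C]_n) :
  u \in unitmx -> v \in unitmx ->
  (invmx u *m diag_mx d *m u) *m w = w *m (invmx v *m diag_mx e *m v) ->
  (invmx u *m diag_mx (map_mx f d) *m u) *m w =
  w *m (invmx v *m diag_mx (map_mx f e) *m v).
Proof.
move=> uu vu; have uV := mulmxV uu; have Vu := mulVmx uu.
have vV := mulmxV vu; have Vv := mulVmx vu.
move: (invmx u) (invmx v) uV Vu vV Vv => u' v' uV Vu vV Vv dw.
have {dw} : diag_mx d *m (u *m w *m v') = (u *m w *m v') *m diag_mx e.
  have := congr1 (fun x => u *m x *m v') dw.
  by rewrite !mulmxA uV mul1mx -(mulmxA _ v v') vV mulmx1.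
move=> /(diag_intertwine f); move: (diag_mx _) (diag_mx _) => D E DE.
have := congr1 (fun x => u' *m x *m v) DE.
by rewrite !mulmxA Vu mul1mx -(mulmxA _ v' v) Vv mulmx1.
Qed.

Lemma mxfun_intertwine f a b w : positive_op a -> positive_op b ->
  a *m w = w *m b -> mxfun f a *m w = w *m mxfun f b.
Proof.
move=> /normal_positive/orthomx_spectralP aE.
move=> /normal_positive/orthomx_spectralP bE awb.
apply: diag_intertwine_conj; [exact: spectral_unit..|].
by rewrite -aE -bE.
Qed.

Lemma mxfun_comp f g a : positive_op (mxfun g a) ->
  mxfun f (mxfun g a) = mxfun (f \o g) a.
Proof.
move=> /normal_positive/orthomx_spectralP bE.
rewrite -[LHS]mulmx1 -[RHS]mul1mx [in RHS]/mxfun map_mx_comp.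
apply: diag_intertwine_conj; [exact: spectral_unit..|].
by rewrite mulmx1 mul1mx; exact: esym bE.
Qed.

End functional_calculus.

(** * Monotonicity of the square root and the mean of invertible operators *)

Section square_root.
Variables (R : realType) (n : nat).
Local Notation C := R[i].
Local Notation op := 'M[C]_n.
Implicit Types (a b x y : op).

Lemma sqrtop_positive a : positive_op a -> positive_op (sqrtop a).
Proof. by move=> a0; apply: mxfun_positive => // t; rewrite sqrtC_ge0. Qed.

Lemma ginv_positive a : positive_op a -> positive_op (ginv a).
Proof. by move=> a0; apply: mxfun_positive => // t; rewrite invr_ge0. Qed.

Lemma sqrtop_sqr a : positive_op a -> sqrtop a *m sqrtop a = a.
Proof.
move=> a0; rewrite /sqrtop mxfunM -[RHS](mxfun_id a0).
by apply: (eq_mxfun a0) => t t0; rewrite -expr2 sqrtCK.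
Qed.

Lemma positive_sqr x : positive_op x -> positive_op (x *m x).
Proof.
move=> x0; rewrite -{1}(positive_adj x0) -[X in X *m _](mulmx1 (x ^t*)).
by apply: positive_op_conj; exact: qform1_ge0.
Qed.

(** This is the uniqueness of the positive square root. *)
Lemma sqrtopK x : positive_op x -> sqrtop (x *m x) = x.
Proof.
move=> x0; have xx : mxfun (fun t => t * t) x = x *m x.
  by rewrite -mxfunM (mxfun_id x0).
rewrite -xx /sqrtop mxfun_comp; last by rewrite xx; exact: positive_sqr.
rewrite -[RHS](mxfun_id x0); apply: (eq_mxfun x0) => t t0.
by rewrite /= -expr2 sqrCK.
Qed.

Lemma sqrtopZ r a : 0 <= r -> positive_op a ->
  sqrtop (r *: a) = sqrtC r *: sqrtop a.
Proof.
move=> r0 a0.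
rewrite -[RHS]sqrtopK; last first.
  by apply: positive_opZ; [rewrite sqrtC_ge0|exact: sqrtop_positive].
by rewrite -scalemxAl -scalemxAr scalerA -expr2 sqrtCK sqrtop_sqr.
Qed.

(** If d is an eigenvalue of y - x with eigenvector v, then
    v* (y^2 - x^2) v = d (v* y v + v* x v), so d cannot be negative. *)
Lemma positive_sqr_le x y : positive_op x -> positive_op y ->
  positive_op (y *m y - x *m x) -> positive_op (y - x).
Proof.
move=> x0 y0 yx0.
have hh : (y - x) ^t* = y - x.
  by rewrite ctmxD ctmxN (positive_adj x0) (positive_adj y0).
have nh : y - x \is normalmx by apply/normalmxP; rewrite hh.
have /orthomx_spectralP -> := nh.
apply: positive_op_diag => [|i]; first exact: spectral_unitarymx.
set h := y - x in hh nh *; set d := spectral_diag h 0 i.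
set v := col i ((spectralmx h) ^t*).
have hv : h *m v = d *: v := spectral_vector i nh.
have dE : d = qform y v - qform x v.
  by rewrite -qformB /d -(qform_spectral i nh).
clearbody d v.
have rd : Num.conj d = d.
  by rewrite conj_Creal// dE rpredB// realE; [rewrite (y0 v)|rewrite (x0 v)].
have : 0 <= qform (y *m y - x *m x) v by exact: yx0.
have -> : y *m y - x *m x = y *m h + h *m x.
  by rewrite /h mulmxBr mulmxBl addrA subrK.
rewrite qformD.
have -> : qform (y *m h) v = d * qform y v.
  by rewrite /qform /sesq mulmxA -(mulmxA _ h v) hv -scalemxAr mxE.
have -> : qform (h *m x) v = d * qform x v.
  rewrite /qform /sesq mulmxA -{1}hh -ctmxM hv ctmxZ rd -!scalemxAl mxE.
  by [].
rewrite -mulrDr => H.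
have y1 : 0 <= qform y v by exact: y0.
have x1 : 0 <= qform x v by exact: x0.
have : 0 <= qform y v ^+ 2 - qform x v ^+ 2 by rewrite subr_sqr -dE.
by rewrite dE !subr_ge0 (@ler_pXn2r _ 2).
Qed.

Lemma sqrtop_le a b : positive_op a -> positive_op b -> positive_op (b - a) ->
  positive_op (sqrtop b - sqrtop a).
Proof.
move=> a0 b0 ba; apply: (positive_sqr_le (sqrtop_positive a0) (sqrtop_positive b0)).
by rewrite (sqrtop_sqr a0) (sqrtop_sqr b0).
Qed.

End square_root.

Section geometric_mean_of_invertible_operators.
Variables (R : realType) (n : nat).
Local Notation C := R[i].
Local Notation op := 'M[C]_n.
Implicit Types (a b x y : op).

Lemma ginv_unit a : positive_op a -> a \in unitmx -> ginv a = invmx a.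
Proof.
move=> a0 au; apply: (can_inj (mulKmx au)); rewrite mulmxV//.
rewrite -{1}(mxfun_id a0) /ginv mxfunM -(mxfun_cst 1 a).
by apply: eq_mxfun_unit => // t t0; rewrite divff// gt_eqF.
Qed.

Lemma sqrtop_ginv_unit a : positive_op a -> a \in unitmx ->
  sqrtop a *m sqrtop (ginv a) = 1%:M.
Proof.
move=> a0 au; rewrite /sqrtop /ginv (mxfun_comp _ (ginv_positive a0)).
rewrite mxfunM -(mxfun_cst 1 a).
apply: eq_mxfun_unit => // t t0 /=.
by rewrite rootCV// ?ltW// divff// sqrtC_eq0 gt_eqF.
Qed.

Lemma ginv_sqrtop_unit a : positive_op a -> a \in unitmx ->
  sqrtop (ginv a) *m sqrtop a = 1%:M.
Proof. by move=> a0 au; apply: mulmx1C; exact: sqrtop_ginv_unit. Qed.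

Lemma positive_op_sandwich a b : positive_op a -> positive_op b ->
  positive_op (b *m a *m b).
Proof. by move=> a0 b0; rewrite -{1}(positive_adj b0); exact: positive_op_conj. Qed.

Lemma gmean_unit_positive a b : positive_op a -> positive_op b ->
  positive_op (gmean_unit a b).
Proof.
move=> a0 b0; have s0 := sqrtop_positive a0.
have w0 := sqrtop_positive (ginv_positive a0).
apply: positive_op_sandwich s0; apply: sqrtop_positive.
exact: positive_op_sandwich w0.
Qed.

(** Conjugation by the square root of the inverse of a turns the Riccati
    equation into x^2 = c with x, c positive. *)
Lemma gmean_unit_riccati a b x : positive_op a -> a \in unitmx ->
  positive_op b -> positive_op x ->
  x *m ginv a *m x = b <-> x = gmean_unit a b.
Proof.
move=> a0 au b0 x0.
have ia0 := ginv_positive a0.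
have tw := sqrtop_ginv_unit a0 au; have wt := ginv_sqrtop_unit a0 au.
have ww := sqrtop_sqr ia0.
have w0 := sqrtop_positive ia0.
rewrite /gmean_unit; move: (sqrtop a) (sqrtop (ginv a)) tw wt ww w0 => t w tw wt ww w0.
split=> [xE|->]; last first.
  have -> : forall k, t *m k *m t *m ginv a *m (t *m k *m t) = t *m (k *m k) *m t.
    move=> k; rewrite -ww !mulmxA; congr (_ *m _ *m _).
    by rewrite -(mulmxA _ t w) tw mulmx1 -(mulmxA _ w t) wt mulmx1.
  rewrite sqrtop_sqr; last exact: positive_op_sandwich.
  by rewrite !mulmxA tw mul1mx -mulmxA wt mulmx1.
have -> : w *m b *m w = (w *m x *m w) *m (w *m x *m w).
  by rewrite -xE -ww !mulmxA.
rewrite sqrtopK; last exact: positive_op_sandwich.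
by rewrite !mulmxA tw mul1mx -mulmxA wt mulmx1.
Qed.

(** Inverting both sides of the equation x a^-1 x = b turns it into
    x b^-1 x = a. *)
Lemma gmean_unitC a b : positive_op a -> a \in unitmx ->
  positive_op b -> b \in unitmx -> gmean_unit a b = gmean_unit b a.
Proof.
move=> a0 au b0 bu; have x0 := gmean_unit_positive a0 b0.
have /(gmean_unit_riccati a0 au b0 x0) := erefl (gmean_unit a b).
move: (gmean_unit a b) x0 => x x0 xE.
apply/(gmean_unit_riccati b0 bu a0 x0).
have : x *m ginv a *m x \in unitmx by rewrite xE.
rewrite !unitmx_mul => /andP[/andP[xu _] _].
have aV := mulVmx au; have bV := mulVmx bu.
have xV := mulVmx xu; have Vx := mulmxV xu.
move: xE; rewrite (ginv_unit a0 au) (ginv_unit b0 bu).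
move: (invmx a) (invmx b) (invmx x) aV bV xV Vx => a' b' y aV bV xV Vx xE.
have -> : b' = y *m a *m y; last by rewrite !mulmxA Vx mul1mx -mulmxA xV mulmx1.
suff byay : b *m (y *m a *m y) = 1%:M.
  by rewrite -[RHS]mul1mx -bV -(mulmxA b') byay mulmx1.
by rewrite -xE !mulmxA -(mulmxA _ x y) Vx mulmx1 -(mulmxA _ a' a) aV mulmx1.
Qed.

Lemma gmean_unit_le a b b' : positive_op a -> positive_op b -> positive_op b' ->
  positive_op (b' - b) -> positive_op (gmean_unit a b' - gmean_unit a b).
Proof.
move=> a0 b0 b0' bb; rewrite /gmean_unit -mulmxBl -mulmxBr.
have w0 := sqrtop_positive (ginv_positive a0).
apply: positive_op_sandwich; last exact: sqrtop_positive.
have cb (c : op) : positive_op c ->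
    positive_op (sqrtop (ginv a) *m c *m sqrtop (ginv a)).
  by move=> c0; exact: positive_op_sandwich w0.
apply: sqrtop_le; [exact: cb b0|exact: cb b0'|].
by rewrite -mulmxBl -mulmxBr; exact: cb bb.
Qed.

Lemma shift_positive a (e : C) : positive_op a -> 0 <= e ->
  positive_op (a + e%:M).
Proof. by move=> a0 e0; apply: positive_opD => //; exact: positive_op_scalar. Qed.

Lemma shift_mxfun a (e : C) : positive_op a ->
  a + e%:M = mxfun (fun t => t + e) a.
Proof. by move=> a0; rewrite -{1}(mxfun_id a0) -(mxfun_cst e a) mxfunD. Qed.

Lemma shift_unit a (e : C) : positive_op a -> 0 < e -> a + e%:M \in unitmx.
Proof.
move=> a0 e0; rewrite shift_mxfun//.
have : mxfun (fun t => t + e) a *m mxfun (fun t => (t + e)^-1) a = 1%:M.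
  rewrite mxfunM -(mxfun_cst 1 a); apply: eq_mxfun => // t t0.
  by rewrite divff// gt_eqF// ltr_wpDl.
by case/mulmx1_unit => [u _]; exact: u.
Qed.

(** The mean is nondecreasing in its second argument because the square root
    is, and in its first argument by symmetry. *)
Lemma gmean_unit_shift_le a b (e e' : C) : positive_op a -> positive_op b ->
  0 < e -> e <= e' ->
  positive_op (gmean_unit (a + e'%:M) (b + e'%:M) -
               gmean_unit (a + e%:M) (b + e%:M)).
Proof.
move=> a0 b0 e0 ee; have e'0 := lt_le_trans e0 ee.
have shle (c : op) : positive_op (c + e'%:M - (c + e%:M)).
  rewrite opprD addrACA subrr add0r -raddfB /=.
  by apply: positive_op_scalar; rewrite subr_ge0.
have P (c : op) (f : C) : positive_op c -> 0 < f -> positive_op (c + f%:M).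
  by move=> c0 f0; apply: shift_positive => //; exact: ltW.
set a1 := a + e%:M; set a2 := a + e'%:M; set b1 := b + e%:M; set b2 := b + e'%:M.
have a10 : positive_op a1 := P _ _ a0 e0.
have a20 : positive_op a2 := P _ _ a0 e'0.
have b10 : positive_op b1 := P _ _ b0 e0.
have b20 : positive_op b2 := P _ _ b0 e'0.
rewrite -(subrK (gmean_unit a1 b2) (gmean_unit a2 b2)) -addrA.
apply: positive_opD; last exact: (gmean_unit_le a10 b10 b20 (shle b)).
rewrite (gmean_unitC a20 (shift_unit a0 e'0) b20 (shift_unit b0 e'0)).
rewrite (gmean_unitC a10 (shift_unit a0 e0) b20 (shift_unit b0 e'0)).
exact: (gmean_unit_le b20 a10 a20 (shle a)).
Qed.

End geometric_mean_of_invertible_operators.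

(** * Entrywise convergence *)

Section complex_parts.
Variable R : rcfType.
Implicit Types x y : R[i].
Local Notation Re := complex.Re.
Local Notation Im := complex.Im.

Lemma complexReD x y : Re (x + y) = Re x + Re y.
Proof. by case: x y => [? ?] []. Qed.

Lemma complexImD x y : Im (x + y) = Im x + Im y.
Proof. by case: x y => [? ?] []. Qed.

Lemma complexReM x y : Re (x * y) = Re x * Re y - Im x * Im y.
Proof. by case: x y => [? ?] []. Qed.

Lemma complexImM x y : Im (x * y) = Re x * Im y + Im x * Re y.
Proof. by case: x y => [? ?] []. Qed.

Lemma complex_eq x y : Re x = Re y -> Im x = Im y -> x = y.
Proof. by case: x y => [? ?] [? ?] /= -> ->. Qed.

Lemma ge0_complexE x : 0 <= x -> x = (Re x)%:C /\ 0 <= Re x.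
Proof. by move=> x0; rewrite -ler0c RRe_real ?ger0_real. Qed.

End complex_parts.

Section entrywise_convergence.
Variables (R : realType) (U : Type).
Local Notation C := R[i].
Local Notation Re := (@complex.Re R).
Local Notation Im := (@complex.Im R).
Implicit Types (F : set_system U) (f g : U -> C).

(** Real and imaginary parts are kept apart because both uses of convergence,
    limits of monotone functions and of measurable functions, concern real
    values; [ccvgP] compares this with convergence in norm. *)
Definition ccvg F f (l : C) : Prop :=
  (Re (f x) @[x --> F] --> Re l) /\ (Im (f x) @[x --> F] --> Im l).

Definition mxcvg p q F (f : U -> 'M[C]_(p, q)) (l : 'M[C]_(p, q)) : Prop :=
  forall i j, ccvg F (fun x => f x i j) (l i j).

Lemma ccvgP F {FF : Filter F} f l : ccvg F f l <->
  forall e : R, 0 < e -> \forall x \near F, `|l - f x| < e%:C.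
Proof.
split=> [[/cvgrPdist_lt fr /cvgrPdist_lt fi] e e0|H].
  have e2 : 0 < e / 2 by rewrite divr_gt0.
  near=> x.
  have -> : l - f x = (Re l - Re (f x))%:C + 'i * (Im l - Im (f x))%:C.
    by rewrite [LHS]complexE; congr (_ + 'i * _); case: (l) (f x) => [? ?] [].
  apply: le_lt_trans (ler_normD _ _) _; rewrite normrM.
  have -> : `|'i : C| = 1 by rewrite complexiE normCi.
  rewrite mul1r !normc_def /= expr0n /= !addr0 !sqrtr_sqr -rmorphD /= ltcR.
  by rewrite (splitr e); apply: ltrD; near: x; [exact: fr|exact: fi].
split; apply/cvgrPdist_lt => e e0; apply: filterS (H e e0) => x lx.
  rewrite -ltcR; apply: le_lt_trans lx.
  by have := normc_ge_Re (l - f x); rewrite complexReD; case: (f x).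
rewrite -ltcR; apply: le_lt_trans lx.
have := normc_ge_Re ((l - f x) * 'i); rewrite ReiNIm normrN complexImD normrM.
by rewrite normCi mulr1; case: (f x).
Unshelve. all: by end_near. Qed.

Lemma ccvgD F {FF : Filter F} f g a b : ccvg F f a -> ccvg F g b ->
  ccvg F (fun x => f x + g x) (a + b).
Proof.
move=> [fr fi] [gr gi]; split; rewrite (complexReD, complexImD).
  by under eq_fun do rewrite complexReD; exact: cvgD.
by under eq_fun do rewrite complexImD; exact: cvgD.
Qed.

Lemma ccvgM F {FF : Filter F} f g a b : ccvg F f a -> ccvg F g b ->
  ccvg F (fun x => f x * g x) (a * b).
Proof.
move=> [fr fi] [gr gi]; split; rewrite (complexReM, complexImM).
  by under eq_fun do rewrite complexReM; apply: cvgB; exact: cvgM.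
by under eq_fun do rewrite complexImM; apply: cvgD; exact: cvgM.
Qed.

Lemma ccvg_cst F {FF : Filter F} a : ccvg F (fun=> a) a.
Proof. by split; exact: cvg_cst. Qed.

Lemma ccvg_sum F {FF : Filter F} (I : Type) (s : seq I) (f : I -> U -> C) a :
  (forall i, ccvg F (f i) (a i)) ->
  ccvg F (fun x => \sum_(i <- s) f i x) (\sum_(i <- s) a i).
Proof.
move=> fa; elim: s => [|i s IH].
  by rewrite big_nil; under eq_fun do rewrite big_nil; exact: ccvg_cst.
by rewrite big_cons; under eq_fun do rewrite big_cons; exact: ccvgD.
Qed.

Lemma ccvg_real F {FF : Filter F} (f : U -> R) (l : R) : f x @[x --> F] --> l ->
  ccvg F (fun x => (f x)%:C) l%:C.
Proof. by move=> fl; split => //=; exact: cvg_cst. Qed.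

Lemma ccvg_unique F {FF : ProperFilter F} f a b :
  ccvg F f a -> ccvg F f b -> a = b.
Proof.
move=> [ar ai] [br bi].
by apply: complex_eq; [move: ar br|move: ai bi]; apply: cvg_unique.
Qed.

Lemma ccvg_near F {FF : Filter F} f g l :
  (\forall x \near F, f x = g x) -> ccvg F f l -> ccvg F g l.
Proof.
by move=> fg [fr fi]; split; [apply: cvg_trans fr|apply: cvg_trans fi];
  apply: near_eq_cvg; apply: filterS fg => x ->.
Qed.

Lemma ccvg_ge0 F {FF : ProperFilter F} f a : ccvg F f a ->
  (\forall x \near F, 0 <= f x) -> 0 <= a.
Proof.
move=> [ar ai] f0.
suff [r0 i0] : 0 <= Re a /\ Im a = 0.
  by case: a r0 i0 {ar ai} => ? ? /= ? ->; rewrite ler0c.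
split.
  rewrite -(cvg_lim _ ar)//; apply: limr_ge; first by apply/cvg_ex; exists (Re a).
  by apply: filterS f0 => x /ge0_complexE[].
apply: (cvg_unique _ ai) => //.
apply: cvg_near_cst; apply: filterS f0 => x /ge0_complexE[-> _].
by [].
Qed.

Lemma mxcvgM p q r F {FF : Filter F} (f : U -> 'M[C]_(p, q))
  (g : U -> 'M[C]_(q, r)) a b :
  mxcvg F f a -> mxcvg F g b -> mxcvg F (fun x => f x *m g x) (a *m b).
Proof.
move=> fa gb i j; rewrite mxE; under eq_fun do rewrite mxE.
by apply: ccvg_sum => k; exact: ccvgM.
Qed.

Lemma mxcvgD p q F {FF : Filter F} (f g : U -> 'M[C]_(p, q)) a b :
  mxcvg F f a -> mxcvg F g b -> mxcvg F (fun x => f x + g x) (a + b).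
Proof.
by move=> fa gb i j; rewrite mxE; under eq_fun do rewrite mxE; exact: ccvgD.
Qed.

Lemma mxcvg_cst p q F {FF : Filter F} (a : 'M[C]_(p, q)) : mxcvg F (fun=> a) a.
Proof. by move=> i j; exact: ccvg_cst. Qed.

Lemma mxcvg_unique p q F {FF : ProperFilter F} (f : U -> 'M[C]_(p, q)) a b :
  mxcvg F f a -> mxcvg F f b -> a = b.
Proof. by move=> fa fb; apply/matrixP => i j; exact: ccvg_unique (fa i j) (fb i j). Qed.

Lemma mxcvg_positive n F {FF : ProperFilter F} (f : U -> 'M[C]_n) a :
  mxcvg F f a -> (\forall x \near F, positive_op (f x)) -> positive_op a.
Proof.
move=> fa f0 v; apply: (@ccvg_ge0 F _ (fun x => (v ^t* *m f x *m v) 0 0)).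
  by apply: mxcvgM; [apply: mxcvgM|]; do ?exact: mxcvg_cst.
by apply: filterS f0 => x; exact.
Qed.

Lemma mxfun_cvg n F {FF : Filter F} (a : 'M[C]_n) (f : U -> C -> C) (g : C -> C) :
  (forall i, ccvg F (fun x => f x (spectral_diag a 0 i)) (g (spectral_diag a 0 i))) ->
  mxcvg F (fun x => mxfun (f x) a) (mxfun g a).
Proof.
move=> fg; rewrite /mxfun; apply: mxcvgM; [apply: mxcvgM|]; do ?exact: mxcvg_cst.
move=> i j; rewrite !mxE; under eq_fun do rewrite !mxE.
case: (i == j) => /=; last first.
  by rewrite mulr0n; under eq_fun do rewrite mulr0n; exact: ccvg_cst.
by rewrite mulr1n; under eq_fun do rewrite mulr1n; exact: fg.
Qed.

End entrywise_convergence.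

(** * Existence of the geometric mean of positive operators *)

Section strong_limits_at_zero.
Variables (R : realType) (n : nat).
Local Notation C := R[i].
Local Notation op := 'M[C]_n.
Implicit Types (a b : op) (F : R -> op).

(** The entries are the values at the vectors of the canonical basis. *)
Lemma sot_cvg0P F a : sot_cvg0 F a <-> mxcvg 0^'+ F a.
Proof.
have ballP v := @cvg_ballP R[i] 'cV[R[i]^o]_n R 0^'+
  (at_right_proper_filter 0) (fun e => F e *m v) (a *m v).
split=> [H i j|H v].
  apply/ccvgP => e e0; have e0' : 0 < e%:C by rewrite ltcR.
  have := (ballP _).1 (H (delta_mx j 0)) _ e0'.
  apply: filterS => x [_ /(_ i 0)]; rewrite -!colE !mxE.
  exact.
apply: (ballP v).2 => e e0.
have [eE _] := ge0_complexE (ltW e0).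
have Fv : mxcvg 0^'+ (fun x => F x *m v) (a *m v).
  by apply: mxcvgM => //; exact: mxcvg_cst.
have e0' : 0 < complex.Re e by rewrite -ltcR -eE.
suff : \forall x \near 0^'+, forall i, `|(a *m v) i 0 - (F x *m v) i 0| < e.
  by apply: filterS => x Hx; split=> // i j; rewrite (ord1 j); exact: Hx.
apply: filter_forall => i.
by rewrite eE; have /ccvgP /(_ _ e0') := Fv i 0.
Qed.

(** Each quadratic form decreases to a limit with e, and polarization expresses
    the entries through finitely many forms. *)
Lemma mxcvg_nondecreasing F :
  (forall e, 0 < e -> positive_op (F e)) ->
  (forall e e', 0 < e -> e <= e' -> positive_op (F e' - F e)) ->
  exists a, mxcvg 0^'+ F a.
Proof.
move=> F0 Fle.
have qcvg v : exists l : C, ccvg 0^'+ (fun e => qform (F e) v) l.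
  have [f fE] : exists f : R -> R, forall e, 0 < e ->
      qform (F e) v = (f e)%:C /\ 0 <= f e.
    exists (fun e => complex.Re (qform (F e) v)) => e e0.
    by apply: ge0_complexE; exact: F0.
  pose I : set R := [set` Interval (BRight 0) (BInfty R false)].
  exists (inf [set f x | x in I])%:C.
  suff : ccvg 0^'+ (fun e => (f e)%:C) (inf [set f x | x in I])%:C.
    apply: ccvg_near; near=> e.
    have e0 : 0 < e by near: e; exact: nbhs_right_gt.
    by have [-> _] := fE e e0.
  apply: ccvg_real; apply: nondecreasing_at_right_cvgr => //.
    move=> e e'; rewrite !in_itv/= !andbT => e0 e0' ee.
    rewrite -lecR; have [<- _] := fE e e0; have [<- _] := fE e' e0'.
    by rewrite -subr_ge0 -qformB; exact: Fle.
  exists 0; move=> y [e eI <-].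
  by apply: (fE e _).2; move: eI; rewrite /= in_itv/= andbT.
pose q v := sval (cid (qcvg v)).
have Hq v : ccvg 0^'+ (fun e => qform (F e) v) (q v) := svalP (cid (qcvg v)).
move: q Hq => q Hq.
exists (\matrix_(i, j) (2^-1 * (q (delta_mx i 0 + delta_mx j 0)
   + - 'i * q (delta_mx i 0 + 'i *: delta_mx j 0)
   + - (1 - 'i) * (q (delta_mx i 0) + q (delta_mx j 0))))) => i j.
rewrite mxE.
have FE e : F e i j = 2^-1 * (qform (F e) (delta_mx i 0 + delta_mx j 0)
   + - 'i * qform (F e) (delta_mx i 0 + 'i *: delta_mx j 0)
   + - (1 - 'i) * (qform (F e) (delta_mx i 0) + qform (F e) (delta_mx j 0))).
  by rewrite entry_sesquilinear polarization !mulNr.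
under eq_fun do rewrite FE.
apply: ccvgM; first exact: ccvg_cst.
apply: ccvgD; [apply: ccvgD|].
- exact: Hq.
- by apply: ccvgM; [exact: ccvg_cst|exact: Hq].
- apply: ccvgM; first exact: ccvg_cst.
  by apply: ccvgD; exact: Hq.
Unshelve. all: by end_near. Qed.

(** The default value in the definition of the mean is never taken. *)
Lemma gmean_cvg a b : positive_op a -> positive_op b ->
  ~~ ((a \in unitmx) && (b \in unitmx)) ->
  mxcvg 0^'+ (fun e => gmean_unit (a + (e%:C)%:M) (b + (e%:C)%:M)) (gmean a b).
Proof.
move=> a0 b0 /negbTE nu; rewrite /gmean nu; set F := (fun e => _).
have [e e0|e e' e0 ee|l Fl] := @mxcvg_nondecreasing F.
- by apply: gmean_unit_positive; apply: shift_positive => //; rewrite ler0c ltW.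
- by apply: gmean_unit_shift_le => //; rewrite ?ltcR ?lecR.
- case: xgetP => [c _ /sot_cvg0P//|/(_ l) []].
  exact/sot_cvg0P.
Qed.

Lemma gmean_positive a b : positive_op a -> positive_op b ->
  positive_op (gmean a b).
Proof.
move=> a0 b0; have [u|nu] := boolP ((a \in unitmx) && (b \in unitmx)).
  by rewrite /gmean u; exact: gmean_unit_positive.
apply: (mxcvg_positive (gmean_cvg a0 b0 nu)); near=> e.
have e0 : 0 <= e by apply: ltW; near: e; exact: nbhs_right_gt.
by apply: gmean_unit_positive; apply: shift_positive => //; rewrite ler0c.
Unshelve. all: by end_near. Qed.

End strong_limits_at_zero.

(** * The mean with a generalised inverse *)

Section mean_with_generalised_inverse.
Variables (R : realType) (n : nat).
Local Notation C := R[i].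
Local Notation op := 'M[C]_n.
Implicit Types (a b phi : op).

(** The orthogonal projection onto the range of a, see [range_projE]. *)
Definition range_proj a : op := sqrtop a *m sqrtop (ginv a).

Lemma ginvK a : positive_op a -> ginv (ginv a) = a.
Proof.
move=> a0; rewrite [LHS]mxfun_comp; last exact: ginv_positive.
rewrite -[RHS](mxfun_id a0); apply: (eq_mxfun a0) => t _ /=.
exact: invrK.
Qed.

Lemma sqrtop_ginvE a : positive_op a ->
  sqrtop (ginv a) = mxfun (fun t => sqrtC t^-1) a.
Proof. by move=> a0; exact: mxfun_comp (ginv_positive a0). Qed.

Lemma range_projE a : positive_op a ->
  range_proj a = mxfun (fun t => (t != 0)%:R) a.
Proof.
move=> a0; rewrite /range_proj (sqrtop_ginvE a0) mxfunM.
apply: (eq_mxfun a0) => t t0; rewrite -rootCMl//.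
by have [->|tn0] := eqVneq t 0; rewrite ?mul0r ?rootC0// divff// rootC1.
Qed.

Lemma sqrtop_ginv_range_proj a : positive_op a ->
  sqrtop (ginv a) *m range_proj a = sqrtop (ginv a).
Proof.
move=> a0; rewrite (range_projE a0) (sqrtop_ginvE a0) mxfunM.
apply: (eq_mxfun a0) => t _; have [->|_] := eqVneq t 0; last by rewrite mulr1.
by rewrite invr0 rootC0 mul0r.
Qed.

Lemma sqrtC_of_real (x : R) : 0 <= x -> sqrtC x%:C = (Num.sqrt x)%:C.
Proof.
move=> x0; rewrite -{1}(sqr_sqrtr x0) rmorphXn /= sqrCK//.
by rewrite ler0c sqrtr_ge0.
Qed.

Lemma inv_of_real (x : R) : (x%:C)^-1 = (x^-1)%:C.
Proof. by rewrite fmorphV. Qed.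

Lemma sqrtop1 : sqrtop (1%:M : op) = 1%:M.
Proof.
by rewrite -{1}(mulmx1 1%:M) sqrtopK//; exact: qform1_ge0.
Qed.

(** The scalar form of the convergence of [perturbed_root] to the square root;
    both sides vanish at t = 0. *)
Lemma cvg_sqrtC_shift (t : C) : 0 <= t ->
  ccvg 0^'+ (fun e : R => (t != 0)%:R * sqrtC (t^-1 + e%:C)^-1) (sqrtC t).
Proof.
move=> t0; have [->|tn0] := eqVneq t 0.
  by rewrite rootC0; under eq_fun do rewrite mul0r; exact: ccvg_cst.
have [tE r0] := ge0_complexE t0; move: (complex.Re t) tE r0 => r tE r0.
have {tn0} rn0 : r != 0 by apply: contra_neq tn0; rewrite tE => ->.
rewrite {t t0}tE sqrtC_of_real//.
apply: (@ccvg_near _ _ _ _ (fun e => (Num.sqrt (r^-1 + e)^-1)%:C)).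
  near=> e; have e0 : 0 < e by near: e; exact: nbhs_right_gt.
  rewrite mul1r inv_of_real -rmorphD inv_of_real sqrtC_of_real// invr_ge0.
  by rewrite addr_ge0 ?invr_ge0// ltW.
apply: ccvg_real.
have -> : Num.sqrt r = Num.sqrt (r^-1 + 0)^-1 by rewrite addr0 invrK.
apply: cvg_at_right_filter.
apply: (@continuous_comp _ _ _ (fun e : R => (r^-1 + e)^-1) Num.sqrt); last first.
  exact: sqrt_continuous.
apply: cvgV; first by rewrite addr0 invr_neq0.
by apply: cvgD; [exact: cvg_cst|exact: cvg_id].
Unshelve. all: by end_near. Qed.

Lemma sandwich_unit a phi : positive_op a -> positive_op phi ->
  ginv a \in unitmx ->
  sqrtop a *m gmean_unit (ginv a) phi *m sqrtop a =
  sqrtop (sqrtop a *m phi *m sqrtop a).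
Proof.
move=> a0 p0 cu; have c0 := ginv_positive a0.
have ST := ginv_sqrtop_unit c0 cu; have TS := sqrtop_ginv_unit c0 cu.
rewrite /gmean_unit; move: ST TS; rewrite (ginvK a0).
move: (sqrtop (ginv a)) (sqrtop a) => t s st ts.
by rewrite !mulmxA st mul1mx -mulmxA ts mulmx1.
Qed.

(** The square root of the inverse of ginv a + e, cut down to the range of a:
    on the kernel of a it would be e^(-1/2), which is unbounded as e -> 0. *)
Definition perturbed_root (a : op) (e : R) : op :=
  mxfun (fun t => (t != 0)%:R * sqrtC (t^-1 + e%:C)^-1) a.

(** Let w be the square root of the inverse of ginv a + e, so that w g w is the
    square root k of m = w (phi + e) w.  As phi vanishes off the range of a, m
    is the identity there, and hence so is k.  So k commutes with the
    projection p onto the range, and (p k p)^2 = p m p. *)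
Lemma perturbed_sandwich a phi (e : R) : positive_op a -> positive_op phi ->
  phi *m range_proj a = phi -> 0 < e ->
  let r := perturbed_root a e in
  let g := gmean_unit (ginv a + (e%:C)%:M) (phi + (e%:C)%:M) in
  (r *m g *m r) *m (r *m g *m r) = r *m (phi + (e%:C)%:M) *m r.
Proof.
move=> a0 p0 pP e0 r g; have ce0 : 0 < e%:C :> C by rewrite ltcR.
have c0 := ginv_positive a0.
set c := ginv a + (e%:C)%:M in g *.
have ce : positive_op c by apply: shift_positive => //; exact: ltW.
have cu : c \in unitmx by exact: shift_unit.
have pe : positive_op (phi + (e%:C)%:M) by apply: shift_positive => //; exact: ltW.
pose w := sqrtop (ginv c).
have cE : c = mxfun (fun t => t^-1 + e%:C) a.
  by rewrite /c /ginv -(mxfun_cst e%:C a) mxfunD.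
have wE : w = mxfun (fun t => sqrtC (t^-1 + e%:C)^-1) a.
  rewrite /w (sqrtop_ginvE ce) {1}cE.
  by apply: mxfun_comp; rewrite -cE.
have PE := range_projE a0; move: (range_proj a) PE pP => P PE pP.
have w0 : positive_op w := sqrtop_positive (ginv_positive ce).
have wt : w *m sqrtop c = 1%:M := ginv_sqrtop_unit ce cu.
have tw : sqrtop c *m w = 1%:M := sqrtop_ginv_unit ce cu.
have gE : g = sqrtop c *m sqrtop (w *m (phi + (e%:C)%:M) *m w) *m sqrtop c by [].
clearbody g w; move: (sqrtop c) wt tw gE => s wt tw gE.
have rE : r = P *m w by rewrite PE wE; exact/esym/mxfunM.
have rE' : r = w *m P.
  rewrite PE wE; apply/esym/(etrans (mxfunM _ _ _)).
  by apply: (eq_mxfun a0) => t _; rewrite mulrC.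
clearbody r.
have P0 : positive_op P by rewrite PE; apply: mxfun_positive => // t _; exact: ler0n.
have PP : P *m P = P.
  rewrite PE mxfunM; apply: (eq_mxfun a0) => t _.
  by case: (t != 0); rewrite ?mulr1 ?mulr0.
have QE : 1%:M - P = mxfun (fun t => (t == 0)%:R) a.
  apply/(canLR (addrK P)); rewrite PE mxfunD -(mxfun_cst 1 a).
  by apply: (eq_mxfun a0) => t _; case: (t == 0); rewrite ?addr0 ?add0r.
have wwQ : e%:C *: (w *m w *m (1%:M - P)) = 1%:M - P.
  rewrite QE wE mxfunM mxfunM mxfunZ; apply: (eq_mxfun a0) => t _.
  have [->|tn0] := eqVneq t 0; last by rewrite !mulr0.
  by rewrite mulr1 invr0 add0r -expr2 sqrtCK mulfV// gt_eqF.
have wP : w *m P = P *m w by rewrite -rE -rE'.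
pose m := w *m (phi + (e%:C)%:M) *m w.
have mQ : m *m (1%:M - P) = 1%:M - P.
  have wQ : w *m (1%:M - P) = (1%:M - P) *m w.
    by rewrite mulmxBr mulmxBl mulmx1 mul1mx wP.
  have pQ : phi *m (1%:M - P) = 0 by rewrite mulmxBr mulmx1 pP subrr.
  rewrite /m -mulmxA wQ mulmxDr mulmxDl !mulmxA -(mulmxA w phi) pQ mulmx0 mul0mx add0r.
  rewrite mul_mx_scalar -!scalemxAl -(mulmxA w) -wQ mulmxA.
  exact: wwQ.
have m0 : positive_op m by exact: positive_op_sandwich.
pose k := sqrtop m.
have k0 : positive_op k by exact: sqrtop_positive.
have kk : k *m k = m by exact: sqrtop_sqr.
have kQ : k *m (1%:M - P) = 1%:M - P.
  rewrite (mxfun_intertwine _ m0 (@qform1_ge0 R n)); last by rewrite mulmx1.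
  by rewrite [mxfun _ _]sqrtop1 mulmx1.
have adjQ : (1%:M - P) ^t* = 1%:M - P by rewrite ctmxD ctmxN ctmx1 (positive_adj P0).
have Qk : (1%:M - P) *m k = 1%:M - P.
  by rewrite -[LHS]trmxCK ctmxM adjQ (positive_adj k0) kQ.
have rgr : r *m g *m r = P *m k *m P.
  rewrite {1}rE rE' gE -/m -/k.
  rewrite !mulmxA -(mulmxA P w) wt mulmx1 -!mulmxA (mulmxA _ w) tw mul1mx.
  by [].
have rmr : r *m (phi + (e%:C)%:M) *m r = P *m m *m P.
  by rewrite {1}rE rE' /m !mulmxA.
rewrite rgr rmr -kk; clearbody k.
have kP : k *m P = P *m k.
  have := etrans kQ (esym Qk); rewrite mulmxBr mulmxBl mulmx1 mul1mx.
  by move=> /addrI/oppr_inj.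
have -> : P *m k *m P = k *m P by rewrite -kP -mulmxA PP.
by rewrite !mulmxA -kP.
Qed.

(** Let e tend to 0 in [perturbed_sandwich] and take positive square roots. *)
Lemma gmean_ginv_sandwich a phi : positive_op a -> positive_op phi ->
  phi *m range_proj a = phi ->
  sqrtop a *m gmean (ginv a) phi *m sqrtop a =
  sqrtop (sqrtop a *m phi *m sqrtop a).
Proof.
move=> a0 p0 pP; have c0 := ginv_positive a0.
have [/andP[cu pu]|nu] := boolP ((ginv a \in unitmx) && (phi \in unitmx)).
  by rewrite /gmean cu pu; exact: sandwich_unit.
have gl := gmean_cvg c0 p0 nu.
have g0 := gmean_positive c0 p0.
have s0 := sqrtop_positive a0.
rewrite -[LHS]sqrtopK; last exact: positive_op_sandwich.
congr sqrtop.
have rl : mxcvg 0^'+ (perturbed_root a) (sqrtop a).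
  by apply: mxfun_cvg => i; apply: cvg_sqrtC_shift; exact: spectral_ge0.
have cvgMx (f g : R -> op) x y : mxcvg 0^'+ f x -> mxcvg 0^'+ g y ->
    mxcvg 0^'+ (fun e => f e *m g e) (x *m y) by exact: mxcvgM.
have rgr := cvgMx _ _ _ _ (cvgMx _ _ _ _ rl gl) rl.
have pl : mxcvg 0^'+ (fun e : R => phi + (e%:C)%:M) phi.
  rewrite -[X in mxcvg _ _ X]addr0 -(raddf0 (@scalar_mx C n)).
  apply: mxcvgD; first exact: mxcvg_cst.
  move=> i j; rewrite !mxE; under eq_fun do rewrite !mxE.
  case: (i == j); last by rewrite mulr0n; under eq_fun do rewrite mulr0n; exact: ccvg_cst.
  rewrite mulr1n; under eq_fun do rewrite mulr1n.
  by apply: ccvg_real; apply: cvg_at_right_filter; exact: cvg_id.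
have sq := cvgMx _ _ _ _ rgr rgr.
have rpr := cvgMx _ _ _ _ (cvgMx _ _ _ _ rl pl) rl.
apply: (mxcvg_unique sq) => i j.
apply: (ccvg_near _ (rpr i j)); near=> e.
have e0 : 0 < e by near: e; exact: nbhs_right_gt.
by have /= -> := perturbed_sandwich a0 p0 pP e0.
Unshelve. all: by end_near. Qed.

End mean_with_generalised_inverse.

(** * Measurability of operator-valued functions *)

Section iterations.
Variable K : comPzRingType.

(** Polynomials in t which converge to the square root of t if c > 0 and
    2 c sqrt t <= 1. *)
Fixpoint sqrt_iter (c t : K) k : K :=
  if k is k'.+1 then
    let y := sqrt_iter c t k' in y + c * (t - y * y)
  else 0.

(** Polynomials in t which converge to t^-1 for t > 0, if c is small enough,
    and vanish at t = 0, so that one sequence serves the generalised inverse. *)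
Fixpoint ginv_iter (c t : K) k : K :=
  if k is k'.+1 then
    let y := ginv_iter c t k' in y + c * (t - t * t * y)
  else 0.

End iterations.

Section convergence_of_iterations.
Variable R : realType.
Implicit Types s c t : R.

Lemma cvg_powers q : 0 <= q -> q < 1 -> (fun k : nat => q ^+ k) @ \oo --> (0 : R).
Proof. by move=> q0 q1; apply: cvg_expr; rewrite ger0_norm. Qed.

(** The error obeys s - y' = (s - y) (1 - c (s + y)). *)
Lemma cvg_sqrt_iter c s : 0 <= s -> 0 < c -> c * (s *+ 2) <= 1 ->
  sqrt_iter c (s * s) @ \oo --> s.
Proof.
move=> s0 c0 cs.
have H k : 0 <= sqrt_iter c (s * s) k <= s /\
    s - sqrt_iter c (s * s) k <= s * (1 - c * s) ^+ k.
  elim: k => [|k [/andP[y0 ys] IH]] /=; first by rewrite expr0 mulr1 subr0 !lexx s0.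
  move: (sqrt_iter _ _ _) y0 ys IH => y y0 ys IH.
  have E : s - (y + c * (s * s - y * y)) = (s - y) * (1 - c * (s + y)) by ring.
  have cb : c * (s + y) <= 1.
    by apply: le_trans cs; rewrite ler_wpM2l ?(ltW c0)// mulr2n lerD2l.
  have sy0 : 0 <= s - y by rewrite subr_ge0.
  split.
    apply/andP; split.
      by rewrite addr_ge0// mulr_ge0 ?(ltW c0)// subr_ge0 ler_pM.
    by rewrite -subr_ge0 E mulr_ge0// subr_ge0.
  rewrite E exprSr mulrA; apply: ler_pM => //; first by rewrite subr_ge0.
  by rewrite lerD2l lerN2 ler_wpM2l ?(ltW c0)// lerDl.
have [s00|sn0] := eqVneq s 0.
  apply: cvg_near_cst; apply: nearW => k; apply/eqP.
  by have [] := H k; rewrite s00 eq_le andbC => ->.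
have sp : 0 < s by rewrite lt_neqAle eq_sym sn0.
have cs0 : 0 < c * s by rewrite mulr_gt0.
have cs1 : c * s <= 1 by apply: le_trans cs; rewrite mulrnAr mulr2n lerDl ltW.
have q0 : 0 <= 1 - c * s by rewrite subr_ge0.
have q1 : 1 - c * s < 1 by rewrite ltrBlDr ltrDl.
apply: (@squeeze_cvgr _ _ _ _ (fun k => s - s * (1 - c * s) ^+ k) (cst s)).
- apply: nearW => k; have [/andP[_ ->] h] := H k.
  by rewrite andbT lerBlDr addrC -lerBlDr.
- have sE : s = s - s * 0 by rewrite mulr0 subr0.
  rewrite [X in _ --> X]sE; apply: cvgB; first exact: cvg_cst.
  by apply: cvgM; [exact: cvg_cst|exact: cvg_powers].
- exact: cvg_cst.
Qed.

(** The error after k steps is t^-1 (1 - (c t)^2)^k. *)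
Lemma cvg_ginv_iter c t : 0 <= t -> 0 < c -> c * t <= 1 ->
  ginv_iter (c * c) t @ \oo --> t^-1.
Proof.
move=> t0 c0 ct1; have [->|tn0] := eqVneq t 0.
  rewrite invr0 (_ : ginv_iter _ _ = fun=> 0); first exact: cvg_cst.
  by apply/funext; elim => //= k ->; rewrite !mul0r subrr mulr0 addr0.
have tp : 0 < t by rewrite lt_neqAle eq_sym tn0.
have ct0 : 0 < c * t by rewrite mulr_gt0.
pose q := 1 - (c * t) ^+ 2.
rewrite (_ : ginv_iter _ _ = fun k => t^-1 - t^-1 * q ^+ k); last first.
  apply/funext; elim => [|k IH] /=; first by rewrite expr0 mulr1 subrr.
  by rewrite IH exprSr; move: (q ^+ k) => Q; rewrite /q; field.
have tE : t^-1 = t^-1 - t^-1 * 0 by rewrite mulr0 subr0.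
rewrite [X in _ --> X]tE; apply: cvgB; first exact: cvg_cst.
apply: cvgM; first exact: cvg_cst.
apply: cvg_powers; first by rewrite subr_ge0 expr_le1// ltW.
by rewrite ltrBlDr ltrDl exprn_gt0.
Qed.

End convergence_of_iterations.

Section measurability.
Context d (T : measurableType d) (R : realType).
Local Notation C := R[i].
Local Notation Re := (@complex.Re R).
Local Notation Im := (@complex.Im R).
Implicit Types f g : T -> C.

Lemma cmeasurable_cst z : cmeasurable (fun _ : T => z : C).
Proof. by split; exact: measurable_cst. Qed.

Lemma cmeasurable_real (f : T -> R) : measurable_fun setT f ->
  cmeasurable (fun x => (f x)%:C).
Proof. by move=> mf; split => //; exact: measurable_cst. Qed.

Lemma cmeasurableD f g : cmeasurable f -> cmeasurable g ->
  cmeasurable (fun x => f x + g x).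
Proof.
move=> [fr fi] [gr gi]; split.
  by under eq_fun do rewrite complexReD; exact: measurable_funD.
by under eq_fun do rewrite complexImD; exact: measurable_funD.
Qed.

Lemma cmeasurableM f g : cmeasurable f -> cmeasurable g ->
  cmeasurable (fun x => f x * g x).
Proof.
move=> [fr fi] [gr gi]; split.
  by under eq_fun do rewrite complexReM; apply: measurable_funB; exact: measurable_funM.
by under eq_fun do rewrite complexImM; apply: measurable_funD; exact: measurable_funM.
Qed.

Lemma cmeasurable_sum (I : Type) (s : seq I) (f : I -> T -> C) :
  (forall i, cmeasurable (f i)) -> cmeasurable (fun x => \sum_(i <- s) f i x).
Proof.
move=> mf; elim: s => [|i s IH].
  by under eq_fun do rewrite big_nil; exact: cmeasurable_cst.
by under eq_fun do rewrite big_cons; exact: cmeasurableD.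
Qed.

Lemma cmeasurable_prod (I : Type) (s : seq I) (f : I -> T -> C) :
  (forall i, cmeasurable (f i)) -> cmeasurable (fun x => \prod_(i <- s) f i x).
Proof.
move=> mf; elim: s => [|i s IH].
  by under eq_fun do rewrite big_nil; exact: cmeasurable_cst.
by under eq_fun do rewrite big_cons; exact: cmeasurableM.
Qed.

Lemma cmeasurable_cvg (h : nat -> T -> C) f : (forall k, cmeasurable (h k)) ->
  (forall x, ccvg \oo (h ^~ x) (f x)) -> cmeasurable f.
Proof.
move=> mh hf; split.
  apply: (@measurable_fun_cvg _ _ _ _ (fun k x => Re (h k x))) => [k|x _].
    exact: (mh k).1.
  exact: (hf x).1.
apply: (@measurable_fun_cvg _ _ _ _ (fun k x => Im (h k x))) => [k|x _].
  exact: (mh k).2.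
exact: (hf x).2.
Qed.

Definition mxmeasurable p q (f : T -> 'M[C]_(p, q)) : Prop :=
  forall i j, cmeasurable (fun x => f x i j).

Lemma mxmeasurable_cst p q (a : 'M[C]_(p, q)) : mxmeasurable (fun=> a).
Proof. by move=> i j; exact: cmeasurable_cst. Qed.

Lemma mxmeasurableD p q (f g : T -> 'M[C]_(p, q)) :
  mxmeasurable f -> mxmeasurable g -> mxmeasurable (fun x => f x + g x).
Proof.
by move=> mf mg i j; under eq_fun do rewrite mxE; exact: cmeasurableD.
Qed.

Lemma mxmeasurableM p q r (f : T -> 'M[C]_(p, q)) (g : T -> 'M[C]_(q, r)) :
  mxmeasurable f -> mxmeasurable g -> mxmeasurable (fun x => f x *m g x).
Proof.
move=> mf mg i j; under eq_fun do rewrite mxE.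
by apply: cmeasurable_sum => k; exact: cmeasurableM.
Qed.

Lemma mxmeasurableZ p q (c : T -> C) (f : T -> 'M[C]_(p, q)) :
  cmeasurable c -> mxmeasurable f -> mxmeasurable (fun x => c x *: f x).
Proof.
by move=> mc mf i j; under eq_fun do rewrite mxE; exact: cmeasurableM.
Qed.

Lemma mxmeasurableB p q (f g : T -> 'M[C]_(p, q)) :
  mxmeasurable f -> mxmeasurable g -> mxmeasurable (fun x => f x - g x).
Proof.
move=> mf mg; under eq_fun do rewrite -scaleN1r; apply: mxmeasurableD => //.
by apply: mxmeasurableZ => //; exact: cmeasurable_cst.
Qed.

Lemma mxmeasurable_cvg p q (h : nat -> T -> 'M[C]_(p, q)) (f : T -> 'M[C]_(p, q)) :
  (forall k, mxmeasurable (h k)) ->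
  (forall x, mxcvg \oo (h ^~ x) (f x)) -> mxmeasurable f.
Proof.
move=> mh hf i j; apply: (@cmeasurable_cvg (fun k x => h k x i j)) => [k|x].
  exact: mh.
exact: hf.
Qed.

Lemma cmeasurable_trace n (f : T -> 'M[C]_n) :
  mxmeasurable f -> cmeasurable (fun x => \tr (f x)).
Proof. by move=> mf; apply: cmeasurable_sum => i; exact: mf. Qed.

Lemma cmeasurable_det n (f : T -> 'M[C]_n) :
  mxmeasurable f -> cmeasurable (fun x => \det (f x)).
Proof.
move=> mf; apply: cmeasurable_sum => s; apply: cmeasurableM.
  exact: cmeasurable_cst.
by apply: cmeasurable_prod => i; exact: mf.
Qed.

Lemma measurable_unitmx n (f : T -> 'M[C]_n) :
  mxmeasurable f -> measurable_fun setT (fun x => f x \in unitmx).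
Proof.
move=> /cmeasurable_det[mr mi].
rewrite (_ : (fun x => _) = (fun x => ~~ ((Re (\det (f x)) == 0) &&
    (Im (\det (f x)) == 0)))); last first.
  apply/funext => x; rewrite unitmxE unitfE; congr (~~ _).
  by rewrite eq_complex.
apply: measurable_neg; apply: measurable_and; apply: measurable_fun_eqr => //;
  exact: measurable_cst.
Qed.

Lemma mxmeasurable_if p q (b : T -> bool) (f g : T -> 'M[C]_(p, q)) :
  measurable_fun setT b -> mxmeasurable f -> mxmeasurable g ->
  mxmeasurable (fun x => if b x then f x else g x).
Proof.
move=> mb mf mg i j; split.
  under eq_fun do rewrite (fun_if (fun m : 'M[C]_(p, q) => Re (m i j))).
  by apply: measurable_fun_ifT => //; [exact: (mf i j).1|exact: (mg i j).1].
under eq_fun do rewrite (fun_if (fun m : 'M[C]_(p, q) => Im (m i j))).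
by apply: measurable_fun_ifT => //; [exact: (mf i j).2|exact: (mg i j).2].
Qed.

End measurability.

Lemma sqrt_iter_morph (K L : comPzRingType) (h : {rmorphism K -> L}) c t k :
  h (sqrt_iter c t k) = sqrt_iter (h c) (h t) k.
Proof.
elim: k => [|k IH] /=; first exact: rmorph0.
by rewrite rmorphD rmorphM rmorphB rmorphM !IH.
Qed.

Lemma ginv_iter_morph (K L : comPzRingType) (h : {rmorphism K -> L}) c t k :
  h (ginv_iter c t k) = ginv_iter (h c) (h t) k.
Proof.
elim: k => [|k IH] /=; first exact: rmorph0.
by rewrite rmorphD rmorphM rmorphB !rmorphM !IH.
Qed.

Section measurable_functional_calculus.
Context d (T : measurableType d) (R : realType) (n : nat).
Local Notation C := R[i].
Local Notation op := 'M[C]_n.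
Implicit Types (A B : T -> op).

Lemma sqrt_iterS c (a : op) k : positive_op a ->
  let y := mxfun (fun t => sqrt_iter c t k) a in
  mxfun (fun t => sqrt_iter c t k.+1) a = y + c *: (a - y *m y).
Proof.
move=> a0 y; rewrite -[X in X - _](mxfun_id a0) /y.
rewrite mxfunM [X in _ *: X]mxfunB mxfunZ mxfunD.
exact: (eq_mxfun a0).
Qed.

Lemma ginv_iterS c (a : op) k : positive_op a ->
  let y := mxfun (fun t => ginv_iter c t k) a in
  mxfun (fun t => ginv_iter c t k.+1) a = y + c *: (a - a *m a *m y).
Proof.
move=> a0 y.
transitivity (y + c *: (mxfun id a - mxfun id a *m mxfun id a *m y)); last first.
  by rewrite (mxfun_id a0).
rewrite /y mxfunM mxfunM [X in _ *: X]mxfunB mxfunZ mxfunD.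
exact: (eq_mxfun a0).
Qed.

(** A positive number that depends measurably on a and suits both iterations at
    every eigenvalue of a: the eigenvalues are at most the trace, and
    2 sqrt t <= 1 + t <= expR t. *)
Definition step_size (a : op) : R := expR (- complex.Re (\tr a)).

Lemma step_size_gt0 a : 0 < step_size a.
Proof. exact: expR_gt0. Qed.

Lemma step_size_bound (a : op) i : positive_op a ->
  step_size a * (1 + complex.Re (spectral_diag a 0 i)) <= 1.
Proof.
move=> a0; rewrite /step_size expRN mulrC ler_pdivrMr ?expR_gt0// mul1r.
apply: le_trans (expR_ge1Dx _); rewrite lerD2l.
by have := spectral_le_trace i a0; rewrite lecE => /andP[].
Qed.

Lemma cmeasurable_step_size A : mxmeasurable A ->
  cmeasurable (fun x => (step_size (A x))%:C).
Proof.
move=> /cmeasurable_trace[mr _]; apply: cmeasurable_real.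
by apply: measurableT_comp => //; exact: measurableT_comp.
Qed.

(** The square root is the limit of polynomials in A whose coefficients depend
    measurably on the point. *)
Lemma mxmeasurable_sqrtop A : (forall x, positive_op (A x)) ->
  mxmeasurable A -> mxmeasurable (fun x => sqrtop (A x)).
Proof.
move=> A0 mA.
pose h k x : op := mxfun (fun t => sqrt_iter (step_size (A x))%:C t k) (A x).
apply: (@mxmeasurable_cvg _ _ _ _ _ h) => [|x].
  elim=> [|k IH].
    suff -> : h 0%N = fun=> 0%:M by exact: mxmeasurable_cst.
    by apply/funext => x; exact: mxfun_cst.
  have -> : h k.+1 = fun x => h k x + (step_size (A x))%:C *: (A x - h k x *m h k x).
    by apply/funext => x; apply: sqrt_iterS.
  apply: mxmeasurableD => //; apply: mxmeasurableZ; first exact: cmeasurable_step_size.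
  by apply: mxmeasurableB => //; exact: mxmeasurableM.
apply: mxfun_cvg => i; have a0 := A0 x.
have b := step_size_bound i a0; have c0 := step_size_gt0 (A x).
have [tE t0] := ge0_complexE (spectral_ge0 i a0).
move: (complex.Re _) tE t0 b => t -> t0 b.
rewrite sqrtC_of_real//; set s := Num.sqrt t.
have s0 : 0 <= s by exact: sqrtr_ge0.
have tE : t = s * s by rewrite -expr2 sqr_sqrtr.
have -> : (fun k => sqrt_iter (step_size (A x))%:C t%:C k) =
    (fun k => (sqrt_iter (step_size (A x)) (s * s) k)%:C).
  by apply/funext => k; rewrite sqrt_iter_morph -tE.
apply: ccvg_real; apply: cvg_sqrt_iter => //; apply: le_trans b.
rewrite ler_wpM2l ?(ltW c0)// tE -subr_ge0.
have -> : 1 + s * s - s *+ 2 = (1 - s) ^+ 2 by ring.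
exact: sqr_ge0.
Qed.

Lemma mxmeasurable_ginv A : (forall x, positive_op (A x)) ->
  mxmeasurable A -> mxmeasurable (fun x => ginv (A x)).
Proof.
move=> A0 mA.
pose c x : C := (step_size (A x))%:C * (step_size (A x))%:C.
pose h k x : op := mxfun (fun t => ginv_iter (c x) t k) (A x).
apply: (@mxmeasurable_cvg _ _ _ _ _ h) => [|x].
  elim=> [|k IH].
    suff -> : h 0%N = fun=> 0%:M by exact: mxmeasurable_cst.
    by apply/funext => x; exact: mxfun_cst.
  have -> : h k.+1 = fun x => h k x + c x *: (A x - A x *m A x *m h k x).
    by apply/funext => x; apply: ginv_iterS.
  have mc : cmeasurable c by apply: cmeasurableM; exact: cmeasurable_step_size.
  apply: mxmeasurableD => //; apply: mxmeasurableZ => //.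
  apply: (mxmeasurableB mA); apply: mxmeasurableM IH.
  exact: mxmeasurableM.
apply: mxfun_cvg => i; have a0 := A0 x.
have b := step_size_bound i a0; have c0 := step_size_gt0 (A x).
have [tE t0] := ge0_complexE (spectral_ge0 i a0).
move: (complex.Re _) tE t0 b => t -> t0 b.
rewrite inv_of_real.
have -> : (fun k => ginv_iter (c x) t%:C k) =
    (fun k => (ginv_iter (step_size (A x) * step_size (A x)) t k)%:C).
  by apply/funext => k; rewrite ginv_iter_morph rmorphM.
apply: ccvg_real; apply: cvg_ginv_iter => //; apply: le_trans b.
by rewrite ler_wpM2l ?(ltW c0)// lerDr.
Qed.

Lemma mxmeasurable_gmean_unit A B :
  (forall x, positive_op (A x)) -> (forall x, positive_op (B x)) ->
  mxmeasurable A -> mxmeasurable B ->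
  mxmeasurable (fun x => gmean_unit (A x) (B x)).
Proof.
move=> A0 B0 mA mB.
have iA0 x : positive_op (ginv (A x)) := ginv_positive (A0 x).
have mS := mxmeasurable_sqrtop A0 mA.
have mW := mxmeasurable_sqrtop iA0 (mxmeasurable_ginv A0 mA).
have WB0 x : positive_op (sqrtop (ginv (A x)) *m B x *m sqrtop (ginv (A x))).
  by apply: positive_op_sandwich (B0 x) _; exact: sqrtop_positive.
have mK := mxmeasurable_sqrtop WB0 (mxmeasurableM (mxmeasurableM mW mB) mW).
exact: mxmeasurableM (mxmeasurableM mS mK) mS.
Qed.

(** For pairs that are not both invertible the mean is the limit along
    e = 1 / (k + 1). *)
Lemma mxmeasurable_gmean A B :
  (forall x, positive_op (A x)) -> (forall x, positive_op (B x)) ->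
  mxmeasurable A -> mxmeasurable B ->
  mxmeasurable (fun x => gmean (A x) (B x)).
Proof.
move=> A0 B0 mA mB.
pose u x := (A x \in unitmx) && (B x \in unitmx).
have mu : measurable_fun setT u.
  by apply: measurable_and; exact: measurable_unitmx.
pose e k : R := k.+1%:R^-1.
have e0 k : 0 < e k by rewrite invr_gt0.
pose sh (a : op) k := a + ((e k)%:C)%:M.
have shA k x : positive_op (sh (A x) k) by apply: shift_positive => //; rewrite ler0c ltW.
have shB k x : positive_op (sh (B x) k) by apply: shift_positive => //; rewrite ler0c ltW.
pose h k x : op :=
  if u x then gmean_unit (A x) (B x) else gmean_unit (sh (A x) k) (sh (B x) k).
apply: (@mxmeasurable_cvg _ _ _ _ _ h) => [k|x].
  have msh (D : T -> op) : mxmeasurable D -> mxmeasurable (fun y => sh (D y) k).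
    by move=> mD; apply: (mxmeasurableD mD); exact: mxmeasurable_cst.
  have m1 := mxmeasurable_gmean_unit A0 B0 mA mB.
  have m2 := mxmeasurable_gmean_unit (shA k) (shB k) (msh _ mA) (msh _ mB).
  exact: mxmeasurable_if mu m1 m2.
rewrite /h; case: (boolP (u x)) => ux.
  by rewrite /gmean -/(u x) ux; exact: mxcvg_cst.
have gl := gmean_cvg (A0 x) (B0 x) ux => i j.
have [gr gi] := gl i j; split.
  by move/cvg_at_rightP: gr => /(_ e); apply; split => //; exact: cvg_harmonic.
by move/cvg_at_rightP: gi => /(_ e); apply; split => //; exact: cvg_harmonic.
Qed.

End measurable_functional_calculus.

(** * Change of measure by the Radon-Nikodym density *)

Section change_of_density.
Context d (T : measurableType d) (R : realType).
Variables mu1 mu2 : {finite_measure set T -> \bar R}.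
Hypothesis mu21 : mu2 `<< mu1.

Lemma ae_integrable (mu : {measure set T -> \bar R}) (f g : T -> \bar R) :
  mu.-integrable setT f -> measurable_fun setT g -> ae_eq mu setT f g ->
  mu.-integrable setT g.
Proof.
move=> /integrableP[mf fi] mg fg; apply/integrableP; split => //.
rewrite -(@ae_eq_integral _ _ _ mu setT (fun x => `|g x|)%E (fun x => `|f x|)%E) //.
- exact: measurableT_comp.
- exact: measurableT_comp.
- exact: ae_eq_abse.
Qed.

Definition density (x : T) : R :=
  fine (('d (charge_of_finite_measure mu2) '/d mu1) x).

Lemma densityE x : (density x)%:E = ('d (charge_of_finite_measure mu2) '/d mu1) x.
Proof. by rewrite /density fineK// Radon_Nikodym_fin_num. Qed.

Lemma measurable_density : measurable_fun setT density.
Proof.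
apply/measurable_EFinP; rewrite (_ : _ \o _ = 'd (charge_of_finite_measure mu2) '/d mu1).
  by [].
by apply/funext => x; exact: densityE.
Qed.

Lemma density_ge0 : \forall x \ae mu1, 0 <= density x.
Proof.
have := ae_eq_Radon_Nikodym_SigmaFinite mu21 measurableT.
apply: filterS => x /(_ I) E; rewrite /density -E fine_ge0//.
exact: Radon_Nikodym_SigmaFinite.f_ge0.
Qed.

(** The absolute value of h may be multiplied by a nonnegative version of the
    density, and this product dominates. *)
Lemma density_integrable (h : T -> R) : mu2.-integrable setT (EFin \o h) ->
  mu1.-integrable setT (EFin \o (fun x => density x * h x)).
Proof.
move=> ih; have mh : measurable_fun setT h.
  by apply/measurable_EFinP; exact: measurable_int ih.
pose k x := (`|h x|)%:E.
have ik : mu2.-integrable setT k by exact: integrable_norm.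
have k0 x : (0 <= k x)%E by rewrite lee_fin.
have := Radon_Nikodym_SigmaFinite.integrableM mu21 k0 measurableT ik.
move=> /ae_integrable H.
have {}H : mu1.-integrable setT (k \* 'd (charge_of_finite_measure mu2) '/d mu1)%E.
  apply: H.
    by apply: emeasurable_funM => //; exact: measurable_int ik.
  apply: ae_eqe_mul2l; exact: ae_eq_Radon_Nikodym_SigmaFinite.
apply: le_integrable H => //.
  by apply/measurable_EFinP; apply: measurable_funM => //; exact: measurable_density.
move=> x _; rewrite /= -densityE /k -EFinM /= lee_fin normrM normrM normr_id.
by rewrite mulrC.
Qed.

Lemma density_Rintegral (h : T -> R) E : measurable E ->
  mu2.-integrable setT (EFin \o h) ->
  \int[mu1]_(x in E) (density x * h x) = \int[mu2]_(x in E) h x.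
Proof.
move=> mE ih; congr fine.
rewrite -(Radon_Nikodym_change_of_variables mu21 mE); last exact: integrableS ih.
by apply: eq_integral => x _; rewrite EFinM densityE muleC.
Qed.

Lemma ae_eq_density (f h : T -> R) :
  mu1.-integrable setT (EFin \o f) -> mu2.-integrable setT (EFin \o h) ->
  (forall E, measurable E -> \int[mu1]_(x in E) f x = \int[mu2]_(x in E) h x) ->
  \forall x \ae mu1, f x = density x * h x.
Proof.
move=> fi hi fh; have dhi := density_integrable hi.
have : ae_eq mu1 setT (EFin \o f) (EFin \o (fun x => density x * h x)).
  apply: integral_ae_eq => //; first exact: measurable_int dhi.
  move=> E _ mE.
  have fE : mu1.-integrable E (EFin \o f) by exact: integrableS fi.
  have dE : mu1.-integrable E (EFin \o (fun x => density x * h x)).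
    exact: integrableS dhi.
  rewrite -(fineK (integrable_fin_num mE fE)) -(fineK (integrable_fin_num mE dE)).
  by congr EFin; have := fh E mE; rewrite -density_Rintegral.
by apply: filterS => x /(_ I) [].
Qed.

End change_of_density.

Section complex_change_of_density.
Context d (T : measurableType d) (R : realType).
Variables mu1 mu2 : {finite_measure set T -> \bar R}.
Hypothesis mu21 : mu2 `<< mu1.
Local Notation C := R[i].
Implicit Types f g h : T -> C.

Lemma ae_eq_cintegrable (mu : {measure set T -> \bar R}) f g :
  cintegrable mu f -> cmeasurable g -> (\forall x \ae mu, f x = g x) ->
  cintegrable mu g.
Proof.
move=> [fr fi] [gr gi] fg; split.
  apply: ae_integrable fr _ _; first exact/measurable_EFinP.
  by apply: filterS fg => x -> _.
apply: ae_integrable fi _ _; first exact/measurable_EFinP.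
by apply: filterS fg => x -> _.
Qed.

Lemma cintegrable_cmeasurable (mu : {measure set T -> \bar R}) f :
  cintegrable mu f -> cmeasurable f.
Proof.
by move=> [fr fi]; split; apply/measurable_EFinP;
  [exact: measurable_int fr|exact: measurable_int fi].
Qed.

Lemma ae_eq_cintegral (mu : {measure set T -> \bar R}) f g :
  cmeasurable f -> cmeasurable g -> (\forall x \ae mu, f x = g x) ->
  cintegral mu setT f = cintegral mu setT g.
Proof.
move=> [fr fi] [gr gi] fg; congr (_ +i* _); congr fine;
  apply: ae_eq_integral => //; do ?exact/measurable_EFinP;
  by apply: filterS fg => x -> _.
Qed.

Lemma complex_Re_scale (r : R) (z : C) : complex.Re (r%:C * z) = r * complex.Re z.
Proof. by rewrite complexReM /= mul0r subr0. Qed.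

Lemma complex_Im_scale (r : R) (z : C) : complex.Im (r%:C * z) = r * complex.Im z.
Proof. by rewrite complexImM /= mul0r addr0. Qed.

Lemma density_cintegrable h : cintegrable mu2 h ->
  cintegrable mu1 (fun x => (density mu1 mu2 x)%:C * h x).
Proof.
move=> [hr hi]; split.
  under eq_fun do rewrite complex_Re_scale; exact: (density_integrable mu21 hr).
under eq_fun do rewrite complex_Im_scale; exact: (density_integrable mu21 hi).
Qed.

Lemma density_cintegral h E : measurable E -> cintegrable mu2 h ->
  cintegral mu1 E (fun x => (density mu1 mu2 x)%:C * h x) = cintegral mu2 E h.
Proof.
move=> mE [hr hi]; rewrite /cintegral; congr (_ +i* _).
  under [LHS]eq_Rintegral do rewrite complex_Re_scale.
  exact: (density_Rintegral mu21 mE hr).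
under [LHS]eq_Rintegral do rewrite complex_Im_scale.
exact: (density_Rintegral mu21 mE hi).
Qed.

Lemma ae_eq_cdensity f h : cintegrable mu1 f -> cintegrable mu2 h ->
  (forall E, measurable E -> cintegral mu1 E f = cintegral mu2 E h) ->
  \forall x \ae mu1, f x = (density mu1 mu2 x)%:C * h x.
Proof.
move=> [fr fi] [hr hi] fh.
have Er : \forall x \ae mu1, complex.Re (f x) = density mu1 mu2 x * complex.Re (h x).
  by apply: (ae_eq_density mu21 fr hr) => E mE; have [] := fh E mE.
have Ei : \forall x \ae mu1, complex.Im (f x) = density mu1 mu2 x * complex.Im (h x).
  by apply: (ae_eq_density mu21 fi hi) => E mE; have [] := fh E mE.
apply: filterS2 Er Ei => x er ei; apply: complex_eq.
  by rewrite complex_Re_scale.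
by rewrite complex_Im_scale.
Qed.

End complex_change_of_density.

(** * Transfer of expectations between positive operator valued measures *)

Section sandwiched_product.
Variables (R : realType) (n : nat).
Local Notation C := R[i].
Local Notation op := 'M[C]_n.
Implicit Types (a b phi psi : op).

(** With s the square root of a, the operator s g s is the square root of r b,
    that is the square root of b times that of r. *)
Lemma product_sandwich a b phi psi (r : R) :
  positive_op a -> positive_op b -> positive_op phi -> 0 <= r ->
  phi *m range_proj a = phi -> sqrtop a *m phi *m sqrtop a = r%:C *: b ->
  let g := gmean (ginv a) phi in
  sqrtop a *m (g *m sqrtop a *m psi *m sqrtop a *m g) *m sqrtop a =
  r%:C *: (sqrtop b *m psi *m sqrtop b).
Proof.
move=> a0 b0 p0 r0 pP sps g.
have := gmean_ginv_sandwich a0 p0 pP; rewrite sps sqrtopZ ?ler0c// -/g => sgs.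
clearbody g; move: (sqrtop a) sgs => s sgs.
have -> : s *m (g *m s *m psi *m s *m g) *m s =
    (s *m g *m s) *m psi *m (s *m g *m s) by rewrite !mulmxA.
by rewrite sgs -!scalemxAl -scalemxAr scalerA -expr2 sqrtCK.
Qed.

End sandwiched_product.

Section povm_lemmas.
Context d (T : measurableType d) (R : realType) (n : nat).
Local Notation C := R[i].
Local Notation op := 'M[C]_n.
Implicit Types (nu : povm T R n) (A phi psi : T -> op).

(** The trace of a positive operator vanishes only if the operator does. *)
Lemma trace_measure_eq0 nu E : measurable E ->
  trace_measure nu E = 0%E <-> nu E = 0.
Proof.
move=> mE; have p0 := povm_positive nu mE.
rewrite /trace_measure mem_set//; split=> [[]|->]; last by rewrite mxtrace0 mulr0.
(* In dimension 0 the normalising factor is 0, and all operators are equal. *)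
move=> /eqP; rewrite mulf_eq0 => /orP[|/eqP t0].
  rewrite invr_eq0 pnatr_eq0 => /eqP n0.
  by apply/matrixP => i; have := ltn_ord i; rewrite [X in (_ < X)%N]n0.
apply: positive_trace_eq0 => //; apply: complex_eq => //=.
apply: ger0_Im; apply: sumr_ge0 => i _.
by rewrite entry_sesquilinear; exact: p0.
Qed.

Lemma trace_measure_dominates nu1 nu2 : povm_ac nu2 nu1 ->
  trace_measure nu2 `<< trace_measure nu1.
Proof.
move=> ac; apply/null_content_dominatesP => E mE /(trace_measure_eq0 nu1 mE) /ac.
by move=> /(_ mE) /(trace_measure_eq0 nu2 mE).
Qed.

Lemma povm_ae_trace_measure nu (P : T -> Prop) : povm_ae nu P ->
  \forall x \ae trace_measure nu, P x.
Proof.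
move=> [N [mN N0 NP]]; exists N; split => //; first exact/trace_measure_eq0.
by move=> x /= nPx; apply: contrapT => /NP.
Qed.

Lemma qrv_mxmeasurable psi : qrv psi -> mxmeasurable psi.
Proof.
move=> mpsi i j.
have : cmeasurable (fun x => \tr (delta_mx j i *m psi x)).
  apply: (@state_span _ _ (fun r => cmeasurable (fun x => \tr (r *m psi x)))) => //.
  - by under eq_fun do rewrite mul0mx mxtrace0; exact: cmeasurable_cst.
  - move=> a b ma mb; under eq_fun do rewrite mulmxDl mxtraceD.
    exact: cmeasurableD.
  - move=> z a ma; under eq_fun do rewrite -scalemxAl mxtraceZ.
    by apply: cmeasurableM => //; exact: cmeasurable_cst.
rewrite (_ : (fun x => \tr _) = (fun x => psi x i j))//.
by apply/funext => x; exact: mxtrace_delta.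
Qed.

Lemma cmeasurable_trace_mul psi rho : mxmeasurable psi ->
  cmeasurable (fun x => \tr (rho *m psi x)).
Proof.
move=> mpsi; apply: cmeasurable_trace; exact: mxmeasurableM.
Qed.

Lemma density_mxmeasurable nu A : is_density nu A -> mxmeasurable A.
Proof. by move=> [_ iA _] i j; exact: cintegrable_cmeasurable (iA i j). Qed.

Lemma cintegrable_indic (mu : {measure set T -> \bar R}) (f : T -> C) E :
  measurable E -> cintegrable mu f -> cintegrable mu (fun x => (\1_E x)%:C * f x).
Proof.
move=> mE [fr fi].
have I (h : T -> R) : mu.-integrable setT (EFin \o h) ->
    mu.-integrable setT (fun x => (\1_E x * h x)%:E).
  move=> ih; have : mu.-integrable E (EFin \o h) by exact: integrableS ih.
  move=> /(integrable_mkcond _ mE); apply: eq_integrable => // x _.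
  by rewrite /= patchE indicE; case: (x \in E); rewrite ?mul1r ?mul0r.
split.
  by under eq_fun do rewrite complex_Re_scale; exact: I.
by under eq_fun do rewrite complex_Im_scale; exact: I.
Qed.

Lemma cintegral_indic (mu : {measure set T -> \bar R}) (f : T -> C) E :
  cintegral mu setT (fun x => (\1_E x)%:C * f x) = cintegral mu E f.
Proof.
have I (h : T -> R) : \int[mu]_x (\1_E x * h x) = \int[mu]_(x in E) h x.
  rewrite [RHS]Rintegral_mkcond; apply: eq_Rintegral => x _.
  by rewrite patchE indicE; case: (x \in E); rewrite ?mul1r ?mul0r.
rewrite /cintegral; congr (_ +i* _).
  by under [LHS]eq_Rintegral do rewrite complex_Re_scale; exact: I.
by under [LHS]eq_Rintegral do rewrite complex_Im_scale; exact: I.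
Qed.

Lemma psi_state_indic A phi rho E x :
  psi_state A (fun y => (\1_E y)%:C *: phi y) rho x =
  (\1_E x)%:C * psi_state A phi rho x.
Proof. by rewrite /psi_state -!scalemxAr -!scalemxAl -scalemxAr mxtraceZ. Qed.

(** The expectation is defined by its traces against states; these span all
    operators. *)
Lemma trace_povm_integral nu A phi E rho : povm_integrable nu A phi ->
  measurable E ->
  \tr (rho *m povm_integral nu A E phi) =
  cintegral (trace_measure nu) E (psi_state A phi rho).
Proof.
move=> iphi mE; rewrite -cintegral_indic.
pose ph y := (\1_E y)%:C *: phi y.
have ip r : cintegrable (trace_measure nu) (fun x => (\1_E x)%:C * psi_state A phi r x).
  by apply: cintegrable_indic => //; exact: povm_integrable_psi_state.
have phE r : psi_state A ph r = fun x => (\1_E x)%:C * psi_state A phi r x.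
  by apply/funext => x; exact: psi_state_indic.
have ipE : povm_integrable nu A ph by move=> r _; rewrite phE.
have st := (povm_expectationP ipE (povm_integral nu A E phi)).2 erefl.
pose P r := \tr (r *m povm_integral nu A E phi) =
  cintegral (trace_measure nu) setT (fun x => (\1_E x)%:C * psi_state A phi r x).
apply: (@state_span _ _ P).
- rewrite /P mul0mx mxtrace0.
  rewrite (_ : (fun x => _) = fun=> 0); last first.
    by apply/funext => x; rewrite /psi_state mul0mx mxtrace0 mulr0.
  by rewrite /cintegral /= !Rintegral_cst// !mul0r.
- move=> a b aE bE; rewrite /P mulmxDl mxtraceD aE bE -(cintegralD (ip a) (ip b)).
  congr (cintegral _ _ _); apply/funext => x.
  by rewrite /psi_state mulmxDl mxtraceD mulrDr.
- move=> z a aE; rewrite /P -scalemxAl mxtraceZ aE -(cintegralZ _ (ip a)).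
  congr (cintegral _ _ _); apply/funext => x.
  by rewrite /psi_state -scalemxAl mxtraceZ mulrCA.
- by move=> r sr; rewrite /P st// phE.
Qed.

(** Over every measurable set E, the entries of both sides have those of nu2 E
    as their integrals. *)
Lemma RN_derivative_compression nu1 nu2 A1 A2 phi :
  povm_ac nu2 nu1 -> is_density nu2 A2 -> povm_integrable nu1 A1 phi ->
  (forall E, measurable E -> nu2 E = povm_integral nu1 A1 E phi) ->
  \forall x \ae trace_measure nu1,
    sqrtop (A1 x) *m phi x *m sqrtop (A1 x) =
    (density (trace_measure nu1) (trace_measure nu2) x)%:C *: A2 x.
Proof.
move=> ac [_ iA2 nu2E] iphi nu2phi; have dom := trace_measure_dominates ac.
suff : \forall x \ae trace_measure nu1, forall i j,
    psi_state A1 phi (delta_mx j i) x =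
    (density (trace_measure nu1) (trace_measure nu2) x)%:C * A2 x i j.
  apply: filterS => x Hx; apply/matrixP => i j; rewrite [RHS]mxE -Hx.
  by rewrite /psi_state mxtrace_delta.
apply: filter_forall => i; apply: filter_forall => j.
apply: (ae_eq_cdensity dom) => //; first exact: povm_integrable_psi_state.
move=> E mE; rewrite -trace_povm_integral// -nu2phi// mxtrace_delta.
by rewrite nu2E// mxE.
Qed.

(** The explicit expression for phi serves to show that phi vanishes off the
    range of A1; its value comes from [RN_derivative_compression]. *)
Lemma boxtimes_psi_state nu1 nu2 A1 A2 phi psi rho :
  povm_ac nu2 nu1 -> is_density nu1 A1 -> is_density nu2 A2 ->
  is_RN_derivative nu1 nu2 A1 A2 phi ->
  \forall x \ae trace_measure nu1, psi_state A1 (boxtimes A1 phi psi) rho x =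
    (density (trace_measure nu1) (trace_measure nu2) x)%:C *
    psi_state A2 psi rho x.
Proof.
move=> ac dA1 dA2 [phi0 _ iphi nu2phi /povm_ae_trace_measure phiE].
have [A10 _ _] := dA1; have [A20 _ _] := dA2.
have cE := RN_derivative_compression ac dA2 iphi nu2phi.
have r0 := density_ge0 (trace_measure_dominates ac).
apply: filterS3 phiE cE r0 => x xE sps r0.
have pP : phi x *m range_proj (A1 x) = phi x.
  by rewrite xE /RN_formula -scalemxAl -mulmxA sqrtop_ginv_range_proj.
rewrite /psi_state.
have -> := product_sandwich (psi x) (A10 x) (A20 x) (phi0 x) r0 pP sps.
by rewrite -scalemxAr mxtraceZ.
Qed.

Lemma mxmeasurable_boxtimes A phi psi : (forall x, positive_op (A x)) ->
  (forall x, positive_op (phi x)) -> mxmeasurable A -> mxmeasurable phi ->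
  mxmeasurable psi -> mxmeasurable (boxtimes A phi psi).
Proof.
move=> A0 p0 mA mphi mpsi.
have iA0 x : positive_op (ginv (A x)) := ginv_positive (A0 x).
have mS := mxmeasurable_sqrtop A0 mA.
have mg := mxmeasurable_gmean iA0 p0 (mxmeasurable_ginv A0 mA) mphi.
exact: mxmeasurableM (mxmeasurableM (mxmeasurableM (mxmeasurableM mg mS) mpsi) mS) mg.
Qed.

End povm_lemmas.

(** Equality almost everywhere carries over integrability and the integral,
    because both sides are measurable everywhere. *)
Theorem change_of_povm d (T : measurableType d) (R : realType) n
    (nu1 nu2 : povm T R n) (A1 A2 phi psi : T -> 'M[R[i]]_n) :
  povm_ac nu2 nu1 -> is_density nu1 A1 -> is_density nu2 A2 ->
  is_RN_derivative nu1 nu2 A1 A2 phi -> qrv psi -> povm_integrable nu2 A2 psi ->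
  [/\ qrv (boxtimes A1 phi psi),
      povm_integrable nu1 A1 (boxtimes A1 phi psi) &
      povm_expectation nu2 A2 psi = povm_expectation nu1 A1 (boxtimes A1 phi psi)].
Proof.
move=> ac dA1 dA2 dphi qpsi ipsi.
have dom := trace_measure_dominates ac.
have [A10 _ _] := dA1; have [phi0 qphi _ _ _] := dphi.
have mA1 := density_mxmeasurable dA1.
have mbox : mxmeasurable (boxtimes A1 phi psi).
  by apply: mxmeasurable_boxtimes => //; exact: qrv_mxmeasurable.
have mS := mxmeasurable_sqrtop A10 mA1.
have mst rho : cmeasurable (psi_state A1 (boxtimes A1 phi psi) rho).
  exact: cmeasurable_trace_mul (mxmeasurableM (mxmeasurableM mS mbox) mS).
have dst rho : state rho -> cintegrable (trace_measure nu1) (fun x =>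
    (density (trace_measure nu1) (trace_measure nu2) x)%:C *
    psi_state A2 psi rho x).
  by move=> /ipsi; exact: density_cintegrable.
have ibox : povm_integrable nu1 A1 (boxtimes A1 phi psi).
  move=> rho srho; apply: ae_eq_cintegrable (dst _ srho) (mst rho) _.
  by apply: filterS (boxtimes_psi_state psi rho ac dA1 dA2 dphi) => x ->.
split; [by move=> rho _; exact: (cmeasurable_trace_mul rho mbox)|exact: ibox|].
apply/(povm_expectationP ibox) => rho srho.
rewrite ((povm_expectationP ipsi _).2 erefl rho srho).
rewrite -(density_cintegral dom measurableT (ipsi _ srho)).
apply: ae_eq_cintegral => //; first exact: cintegrable_cmeasurable (dst _ srho).
by apply: filterS (boxtimes_psi_state psi rho ac dA1 dA2 dphi) => x ->.
Qed.

End ChangeOfMeasure.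

Local Open Scope classical_set_scope.
Local Open Scope ring_scope.

Theorem mainTheorem2 (R : realType) (X : ptopologicalType)
    (X_hausdorff : hausdorff_space X)
    (X_locally_compact : locally_compact [set: X])
    (n : nat) (nu1 nu2 : povm (borel X) R n)
    (nu1_unit : nu1 setT = 1%:M) (nu2_unit : nu2 setT = 1%:M)
    (nu2_ac_nu1 : povm_ac nu2 nu1)
    (A1 A2 phi : borel X -> 'M[R[i]]_n)
    (A1_density : is_density nu1 A1) (A2_density : is_density nu2 A2)
    (phi_derivative : is_RN_derivative nu1 nu2 A1 A2 phi)
    (psi : borel X -> 'M[R[i]]_n)
    (psi_qrv : qrv psi) (psi_integrable : povm_integrable nu2 A2 psi) :
  [/\ qrv (boxtimes A1 phi psi),
      povm_integrable nu1 A1 (boxtimes A1 phi psi) &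
      povm_expectation nu2 A2 psi = povm_expectation nu1 A1 (boxtimes A1 phi psi)].
Proof.
exact: (ChangeOfMeasure.change_of_povm nu2_ac_nu1 A1_density A2_density
  phi_derivative psi_qrv psi_integrable).
Qed.
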